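(* For any $\alpha:\{1,\dots,n\}\to I\sqcup J$, define a polynomial $R_\alpha$ in (commuting) indeterminates $X_K$, indexed by non-empty subsets $K\subseteq\{1,\dots,n\}$, by $$R_\alpha=\sum_{\pi\in BNC(\alpha)}\mu_{BNC}(\pi,1_\alpha)\prod_{V\in\pi}X_V.$$ If $X_K$ is given degree $|K|$, then $R_\alpha$ is homogeneous of degree $n$. For $z$ a two-faced family in a non-commutative probability space $(\mathcal A,\varphi)$, let $R_\alpha(z)$ denote $R_\alpha$ evaluated at $X_{\{k_1<\cdots<k_r\}}=\varphi(z_{\alpha(k_1)}\cdots z_{\alpha(k_r)})$. Then $R_\alpha(z)=\kappa_\alpha(z)$. Moreover, if $z'$ and $z''$ are bi-free in $(\mathcal A,\varphi)$, then $R_\alpha(z'+z'')=R_\alpha(z')+R_\alpha(z'')$; that is, $R_\alpha$ has the cumulant property.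
   Context: A non-commutative probability space $(\mathcal{A},\varphi)$ is a unital complex algebra with a linear functional $\varphi$, $\varphi(1)=1$. $I,J$ are disjoint index sets; a two-faced family $z=((z_i)_{i\in I},(z_j)_{j\in J})$ consists of elements $z_k\in\mathcal A$, $k\in I\sqcup J$. $z'+z''$ is the two-faced family with entries $z'_k+z''_k$. Bi-non-crossing partitions. For $\chi:\{1,\dots,n\}\to\{\ell,r\}$ write $\chi^{-1}(\ell)=\{i_1<\cdots<i_p\}$, $\chi^{-1}(r)=\{j_1<\cdots<j_{n-p}\}$, and let $s_\chi\in S_n$ be $s_\chi(k)=i_k$ for $k\le p$, $s_\chi(k)=j_{n+1-k}$ for $k>p$. $BNC(\chi)$ is the lattice (under refinement) of partitions $\pi$ of $\{1,\dots,n\}$ such that $s_\chi^{-1}\cdot\pi$ is non-crossing. For $\alpha:\{1,\dots,n\}\to I\sqcup J$, $BNC(\alpha)=BNC(\chi)$ with $\chi(k)=\ell$ if $\alpha(k)\in I$, $\chi(k)=r$ if $\alpha(k)\in J$; its maximum is $1_\alpha=\{\{1,\dots,n\}\}$. $\mu_{BNC}$ is the Möbius function of this lattice: $\sum_{\pi\le\rho\le\sigma}\mu_{BNC}(\pi,\rho)=1$ if $\pi=\sigma$ and $0$ if $\pi<\sigma$. Cumulants. The functionals $\kappa_\chi:\mathcal A^n\to\mathbb C$ are the multilinear functionals uniquely determined by $\varphi(a_1\cdots a_n)=\sum_{\pi\in BNC(\chi)}\prod_{V\in\pi}\kappa_{\chi|_V}((a_1,\dots,a_n)|V)$ for all $n\ge1$,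 $\chi$, $a_1,\dots,a_n\in\mathcal A$, where for $V=\{v_1<\cdots<v_m\}$, $\chi|_V(t)=\chi(v_t)$ and $(a_1,\dots,a_n)|V=(a_{v_1},\dots,a_{v_m})$. $\kappa_\alpha(z)=\kappa_\chi(z_{\alpha(1)},\dots,z_{\alpha(n)})$ with $\chi:\{1,\dots,n\}\to\{\ell,r\}$ determined by $\alpha$ via $\chi(k)=\ell$ if $\alpha(k)\in I$ and $\chi(k)=r$ if $\alpha(k)\in J$. Free products. A vector space with specified state-vector $(\mathcal X,p,\xi)$ is a complex vector space $\mathcal X=\mathbb C\xi\oplus\mathring{\mathcal X}$, $\xi\neq0$, with $p$ the projection onto $\mathbb C\xi$ with kernel $\mathring{\mathcal X}$. $\mathcal L(\mathcal X)$ is the algebra of all linear maps on $\mathcal X$, with state $\varphi$ given by $p(T\xi)=\varphi(T)\xi$. The free product $(\mathcal X,p,\xi)=(\mathcal X',p',\xi')*(\mathcal X'',p'',\xi'')$ is $\mathcal X=\mathbb C\xi\oplus\bigoplus_{m\ge1}\bigoplus_{\delta_1\ne\delta_2\neq\cdots\ne\delta_m}\mathring{\mathcal X}^{\delta_1}\otimes\cdots\otimes\mathring{\mathcal X}^{\delta_m}$ ($\delta_t\in\{',''\}$, consecutive ones distinct), with $p$ the projection onto $\mathbb C\xi$ killing the other summands. For $\delta\in\{',''\}$, let $\mathcal X(\ell,\delta)$ (resp. $\mathcal X(r,\delta)$) be the sum of $\mathbb C\xi$ and those tensor summands with $\delta_1\ne\delta$ (resp. $\delta_m\neq\delta$). Natural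 identifications (with $\xi^\delta\otimes x\mapsto x$, $x\otimes\xi^\delta\mapsto x$, $y\otimes \xi\mapsto y$, $\xi\otimes y\mapsto y$ for $y\in\mathring{\mathcal X}^\delta$, and concatenation otherwise) give isomorphisms $V_\delta:\mathcal X^\delta\otimes\mathcal X(\ell,\delta)\to\mathcal X$ and $W_\delta:\mathcal X(r,\delta)\otimes\mathcal X^\delta\to\mathcal X$. For $T\in\mathcal L(\mathcal X^\delta)$ put $\lambda^\delta(T)=V_\delta(T\otimes 1)V_\delta^{-1}$ and $\rho^\delta(T)=W_\delta(1\otimes T)W_\delta^{-1}$ in $\mathcal L(\mathcal X)$. Bi-freeness. $z',z''$ are bi-free if there exist such a free product and unital homomorphisms $l^\delta:\mathbb C\langle z_i^\delta: i\in I\rangle\to\mathcal L(\mathcal X^\delta)$, $r^\delta:\mathbb C\langle z_j^\delta: j\in J\rangle\to\mathcal L(\mathcal X^\delta)$, $\delta\in\{',''\}$ (defined on algebras of non-commutative polynomials in formal variables), such that the families $((\lambda^\delta(l^\delta(z_i^\delta)))_{i\in I},(\rho^\delta(r^\delta(z_j^\delta)))_{j\in J})$, $\delta\in\{',''\}$, have in $(\mathcal L(\mathcal X),\varphi)$ the same joint distribution (all joint mixed moments of the two families together) as $z'$ and $z''$ in $(\mathcal A,\varphi)$. *)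

(* Defs.v *)
From HB Require Import structures.
From mathcomp Require Import all_boot all_order all_fingroup all_algebra.
From mathcomp Require Import generic_quotient.
From mathcomp Require Import boolp reals complex.
From mathcomp.multinomials Require Import mpoly.
From mathcomp Require Import -(notations) finmap.
From mathcomp.multinomials Require Import -(notations) monalg.

Set Implicit Arguments.
Unset Strict Implicit.
Unset Printing Implicit Defensive.

Import Order.TTheory GRing.Theory Num.Theory.
Local Open Scope ring_scope.

(* A map [chi : 'I_n -> bool] encodes chi : {1..n} -> {l,r}: [true] is the left
   face, [false] the right one. *)
Section BiNonCrossing.
Variable n : nat.
Implicit Types (chi : 'I_n -> bool) (pi rho sigma : {set {set 'I_n}}).

Definition noncrossing pi : bool :=
  [forall V in pi, forall W in pi, forall a in V, forall b in W, forall c in V, forall d in W,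
     ((a < b)%N && (b < c)%N && (c < d)%N) ==> (V == W)].

Definition s_seq chi : seq 'I_n :=
  enum [pred k | chi k] ++ rev (enum [pred k | ~~ chi k]).

Fact size_s_seq chi : size (s_seq chi) == n.
Proof.
by rewrite size_cat size_rev -!cardE cardC card_ord.
Qed.

Fact uniq_s_seq chi : uniq (s_seq chi).
Proof.
rewrite cat_uniq rev_uniq !enum_uniq andbT /=.
by apply/hasPn => k; rewrite mem_rev !mem_enum inE => /negbTE h; rewrite inE h.
Qed.

Definition s_fun chi (k : 'I_n) : 'I_n := tnth (Tuple (size_s_seq chi)) k.

Fact s_fun_inj chi : injective (s_fun chi).
Proof.
move=> i j; rewrite /s_fun !(tnth_nth i) /= => /eqP.
rewrite nth_uniq ?(eqP (size_s_seq chi)) ?uniq_s_seq //.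
by move/eqP/val_inj.
Qed.

Definition s_perm chi : {perm 'I_n} := perm (@s_fun_inj chi).

(* [(s_perm chi)^-1%g @: V] runs over the blocks of s_chi^{-1} . pi. *)
Definition BNC chi : {set {set {set 'I_n}}} :=
  [set pi | partition pi [set: 'I_n]
          & noncrossing [set (s_perm chi)^-1%g @: V | V : {set 'I_n} in pi]].

Definition refines pi rho : bool :=
  [forall V in pi, [exists W in rho, V \subset W]].

Definition srefines pi rho : bool := refines pi rho && (pi != rho).

(* Recursion mu(pi,sigma) = - sum_{pi <= rho < sigma} mu(pi,rho); [m] is fuel, and
   #|BNC chi| bounds the length of chains.  [muBNC_sum] below is the defining
   property of the Moebius function. *)
Fixpoint mobius_rec (m : nat) chi pi sigma : int :=
  if pi == sigma then 1
  else if m is m'.+1 then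
    - \sum_(rho in BNC chi | refines pi rho && srefines rho sigma) mobius_rec m' chi pi rho
  else 0.

Definition muBNC chi pi sigma : int := mobius_rec #|BNC chi| chi pi sigma.

Definition one_part : {set {set 'I_n}} := [set [set: 'I_n]].

Lemma refines_refl pi : refines pi pi.
Proof.
by apply/forall_inP => V Vpi; apply/exists_inP; exists V.
Qed.

Lemma refines_trans : transitive refines.
Proof.
move=> rho pi sigma /forall_inP h1 /forall_inP h2.
apply/forall_inP => V /h1 /exists_inP[W /h2 /exists_inP[U hU WU] VW].
by apply/exists_inP; exists U => //; apply: subset_trans WU.
Qed.

Lemma refines_anti pi rho : partition pi [set: 'I_n] -> partition rho [set: 'I_n] ->
  refines pi rho -> refines rho pi -> pi = rho.
Proof.
suff sub (p r : {set {set 'I_n}}) : partition p [set: 'I_n] ->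
    refines p r -> refines r p -> p \subset r.
  by move=> hp hr h1 h2; apply/eqP; rewrite eqEsubset !sub.
move=> /and3P[_ tp p0] /forall_inP h1 /forall_inP h2.
apply/subsetP => V Vp; have /exists_inP[W Wr VW] := h1 V Vp.
have /exists_inP[U Up WU] := h2 W Wr.
have VU := subset_trans VW WU.
have eVU : V = U.
  apply/eqP; apply: contraT => nVU.
  have := trivIsetP tp V U Vp Up nVU.
  rewrite -setI_eq0 (setIidPl VU) => V0.
  by rewrite -(eqP V0) Vp in p0.
suff -> : V = W by [].
by apply/eqP; rewrite eqEsubset VW eVU.
Qed.

Lemma mobius_rec_stable chi pi m sigma : sigma \in BNC chi ->
  (#|[set rho in BNC chi | refines pi rho && srefines rho sigma]| <= m)%N ->
  mobius_rec m.+1 chi pi sigma = mobius_rec m chi pi sigma.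
Proof.
elim: m sigma => [|m IH] sigma sB hm.
  rewrite /=; case: eqP => // _.
  rewrite big_pred0 ?oppr0 // => rho.
  by move: hm; rewrite leqn0 cards_eq0 => /eqP/setP/(_ rho); rewrite !inE.
rewrite [LHS]/= [RHS]/=; case: eqP => // _; congr (- _).
apply: eq_bigr => rho /andP[rB /andP[pr rs]].
rewrite -[RHS]IH // -ltnS; apply: leq_trans hm.
apply/proper_card/properP; split.
  apply/subsetP => t; rewrite !inE => /andP[-> /andP[-> /andP[tr ntr]]] /=.
  case/andP: rs => rs nrs.
  rewrite /srefines (refines_trans tr rs) /=.
  apply: contra ntr => /eqP ets; rewrite {}ets in tr *.
  move: sB rB; rewrite !inE => /andP[ps _] /andP[prr _].
  by rewrite (refines_anti ps prr tr rs).
exists rho; first by rewrite inE rB pr rs.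
by rewrite inE /srefines eqxx !andbF.
Qed.

Lemma muBNC_sum chi pi sigma : pi \in BNC chi -> sigma \in BNC chi -> refines pi sigma ->
  \sum_(rho in BNC chi | refines pi rho && refines rho sigma) muBNC chi pi rho
  = (pi == sigma)%:R.
Proof.
move=> pB sB ps.
rewrite (bigD1 sigma) /=; last by rewrite sB ps refines_refl.
have -> : muBNC chi pi sigma = mobius_rec #|BNC chi|.+1 chi pi sigma.
  rewrite [RHS]mobius_rec_stable //; apply: subset_leq_card.
  by apply/subsetP => t; rewrite inE => /andP[].
have eqi rho : (rho \in BNC chi) && (refines pi rho && refines rho sigma) && (rho != sigma)
   = (rho \in BNC chi) && (refines pi rho && srefines rho sigma).
  by rewrite /srefines -!andbA.
rewrite (eq_bigl _ _ eqi) [X in X + _]/=.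
case: eqP => [<-|_]; last by rewrite addNr.
rewrite big1 ?addr0 // => rho /and3P[rB pr /andP[rp nrp]].
move: nrp; rewrite (@refines_anti rho pi) ?eqxx //.
  by move: rB; rewrite inE => /andP[].
by move: pB; rewrite inE => /andP[].
Qed.

End BiNonCrossing.

(* [enum_val] lists [V] increasingly, so [restr f V] is (f v_1, ..., f v_m)
   for V = {v_1 < ... < v_m}. *)
Definition restr (T : Type) n (f : 'I_n -> T) (V : {set 'I_n}) : 'I_#|V| -> T :=
  fun t => f (enum_val t).
Arguments restr {T n} f V t.

Section Cumulants.
Variables (K : fieldType) (A : algType K).

Definition cumulant_family : Type := forall n : nat, ('I_n -> bool) -> ('I_n -> A) -> K.

Definition multilinear n (f : ('I_n -> A) -> K) : Prop :=
  forall (a : 'I_n -> A) (k : 'I_n) (c : K) (x y : A),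
    f [eta a with k |-> c *: x + y] = c * f [eta a with k |-> x] + f [eta a with k |-> y].

(* Only the values at n >= 1 matter: [kappa 0] is never used since partitions
   have non-empty blocks.  Existence is [cumulants_exist] below. *)
Definition is_cumulants (phi : A -> K) (kappa : cumulant_family) : Prop :=
  (forall n (chi : 'I_n -> bool), multilinear (kappa n chi)) /\
  (forall n (chi : 'I_n -> bool) (a : 'I_n -> A), (0 < n)%N ->
     phi (\prod_(i < n) a i) =
     \sum_(pi in BNC chi) \prod_(V in pi) kappa #|V| (restr chi V) (restr a V)).
End Cumulants.

Section CumulantsExist.
Variables (K : fieldType) (A : algType K) (phi : {scalar A}).

Fixpoint kap (m n : nat) (chi : 'I_n -> bool) (a : 'I_n -> A) : K :=
  if m is m'.+1 then
    phi (\prod_(i < n) a i)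
    - \sum_(pi in BNC chi | pi != one_part n)
        \prod_(V in pi) @kap m' #|V| (restr chi V) (restr a V)
  else 0.

Lemma partition_block_gt0 n (pi : {set {set 'I_n}}) V :
  partition pi [set: 'I_n] -> V \in pi -> (0 < #|V|)%N.
Proof.
case/and3P=> _ _ h Vpi; rewrite card_gt0; apply: contraNneq h => <-; exact: Vpi.
Qed.

Lemma partition_block_lt n (pi : {set {set 'I_n}}) V :
  partition pi [set: 'I_n] -> pi != one_part n -> V \in pi -> (#|V| < n)%N.
Proof.
move=> hp ne Vpi; rewrite -[X in (_ < X)%N]card_ord -cardsT; apply: proper_card.
rewrite properT; apply: contraNneq ne => VT; rewrite VT in Vpi.
rewrite eqEsubset sub1set Vpi andbT; apply/subsetP => W Wpi; rewrite inE.
have [//|nW] := eqVneq W setT.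
have /and3P[_ tp _] := hp.
have := trivIsetP tp W setT Wpi Vpi nW.
rewrite -setI_eq0 setIT => /eqP W0.
by have := partition_block_gt0 hp Wpi; rewrite W0 cards0.
Qed.

Lemma kap_stable m n (chi : 'I_n -> bool) a : (0 < n)%N -> (n <= m)%N ->
  kap m chi a = kap m.+1 chi a.
Proof.
elim: m n chi a => [|m IH] n chi a n0 nm; first by case: n n0 nm chi a.
rewrite [LHS]/= [RHS]/=; congr (_ - _); apply: eq_bigr => pi /andP[piB ne].
have hp : partition pi [set: 'I_n] by move: piB; rewrite inE => /andP[].
apply: eq_bigr => V Vpi; rewrite IH //; first exact: partition_block_gt0 Vpi.
by rewrite -ltnS; apply: leq_trans nm; apply: partition_block_lt Vpi.
Qed.

Lemma kap_stable_le m n (chi : 'I_n -> bool) a : (0 < n)%N -> (n <= m)%N ->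
  kap m chi a = kap n chi a.
Proof.
move=> n0 /subnK <-; elim: (m - n)%N => [//|k <-].
by rewrite addSn; apply/esym/kap_stable; rewrite // leq_addl.
Qed.

Definition some_cumulants : cumulant_family A := fun n => kap n (n := n).

Lemma restr_setT (F : cumulant_family A) n (chi : 'I_n -> bool) a :
  F #|[set: 'I_n]| (restr chi setT) (restr a setT) = F n chi a.
Proof.
have e : #|[set: 'I_n]| = n by rewrite cardsT card_ord.
have ev t : enum_val t = cast_ord e t.
  apply: val_inj; rewrite /= /enum_val; set d := enum_default _.
  have lt : (t < n)%N by rewrite -[X in (_ < X)%N]e.
  by rewrite enum_setT -enumT /= nth_enum_ord.
suff gen p (ep : p = n) : F p (fun t => chi (cast_ord ep t)) (fun t => a (cast_ord ep t)) = F n chi a.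
  rewrite -(gen _ e); congr (F _ _ _); apply/funext => t; by rewrite /restr ev.
case: _ / (esym ep) (ep) => {}ep.
by congr (F _ _ _); apply/funext => t; rewrite cast_ord_id.
Qed.

Lemma some_cumulantsE n (chi : 'I_n -> bool) a : (0 < n)%N ->
  phi (\prod_(i < n) a i) =
  \sum_(pi in BNC chi) \prod_(V in pi) some_cumulants (restr chi V) (restr a V).
Proof.
move=> n0; rewrite (bigD1 (one_part n)) /=; last first.
  rewrite inE; apply/andP; split.
    rewrite /one_part /partition /cover big_set1 eqxx trivIset1 inE /=.
    by rewrite eq_sym -card_gt0 cardsT card_ord.
  apply/forall_inP => V /imsetP[V' /set1P -> ->].
  apply/forall_inP => W /imsetP[W' /set1P -> ->].
  by do 4!(apply/forall_inP => ? _); rewrite eqxx implybT.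
rewrite /one_part big_set1 (restr_setT some_cumulants).
rewrite {1}/some_cumulants -(@kap_stable_le n.+1) // [kap n.+1 _ _]/=.
rewrite -[LHS](subrK (\sum_(pi in BNC chi | pi != one_part n)
        \prod_(V in pi) @kap n #|V| (restr chi V) (restr a V))).
congr (_ + _); apply: eq_bigr => pi /andP[piB ne].
have hp : partition pi [set: 'I_n] by move: piB; rewrite inE => /andP[].
apply: eq_bigr => V Vpi; rewrite kap_stable_le //.
  exact: partition_block_gt0 Vpi.
exact/ltnW/(partition_block_lt hp).
Qed.

Lemma prod_upd n (a : 'I_n -> A) k : exists B C, forall x,
  \prod_(i < n) [eta a with k |-> x] i = B * x * C.
Proof.
have : uniq (index_enum 'I_n) := index_enum_uniq _.
have : k \in index_enum 'I_n by rewrite mem_index_enum.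
case/splitPr => s1 s2; rewrite cat_uniq /= negb_or => /and3P[_ /andP[k1 _] /andP[k2 _]].
exists (\prod_(i <- s1) a i), (\prod_(i <- s2) a i) => x.
rewrite big_cat big_cons /= eqxx mulrA; congr (_ * _ * _); apply: eq_big_seq => i.
  by case: eqP => // -> h; rewrite h in k1.
by case: eqP => // -> h; rewrite h in k2.
Qed.

Lemma kap_multilinear m n (chi : 'I_n -> bool) : multilinear (kap m chi).
Proof.
elim: m n chi => [|m IH] n chi a k c x y /=; first by rewrite mulr0 addr0.
have [B [C h]] := prod_upd a k.
rewrite !h mulrDr mulrDl -scalerAr -scalerAl linearP /= mulrBr addrACA -opprD.
congr (_ - _); rewrite mulr_sumr -big_split; apply: eq_bigr => pi /andP[piB _] /=.
have /andP[hp _] : partition pi [set: 'I_n] && true by move: piB; rewrite inE => /andP[->].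
have /and3P[/eqP cov tp _] := hp.
have kc : k \in cover pi by rewrite cov inE.
set V := pblock pi k.
have Vpi : V \in pi by rewrite pblock_mem.
have kV : k \in V by rewrite mem_pblock.
rewrite !(bigD1 V Vpi) /=.
have eo z W : W \in pi -> W != V -> restr [eta a with k |-> z] W = restr a W.
  move=> Wpi nW; apply/funext => t; rewrite /restr /=; case: eqP => // e.
  have kW : k \in W by rewrite -e enum_valP.
  by rewrite /V (def_pblock tp Wpi kW) eqxx in nW.
have eV z : restr [eta a with k |-> z] V = [eta restr a V with enum_rank_in kV k |-> z].
  apply/funext => t; rewrite /restr /= -(inj_eq enum_val_inj) enum_rankK_in //.
have ep z : \prod_(W in pi | W != V) kap m (restr chi W) (restr [eta a with k |-> z] W)
  = \prod_(W in pi | W != V) kap m (restr chi W) (restr a W).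
  by apply: eq_bigr => W /andP[Wpi nW]; rewrite eo.
by rewrite !ep !eV IH mulrDl mulrA.
Qed.

Lemma cumulants_exist : exists kappa, is_cumulants phi kappa.
Proof.
exists some_cumulants; split=> [n chi|n chi a n0]; first exact: kap_multilinear.
exact: some_cumulantsE.
Qed.
End CumulantsExist.

Section RPolynomial.
Variable K : fieldType.

Definition nesub (n : nat) : finType := {V : {set 'I_n} | V != set0}.

(* The non-empty subsets of 'I_n index the indeterminates through [enum_rank]. *)
Definition Rindet (n : nat) (V : nesub n) : {mpoly K[#|nesub n|]} := 'X_(enum_rank V).

(* Degree of a monomial when X_V has degree #|V|. *)
Definition Rweight (n : nat) (m : 'X_{1..#|nesub n|}) : nat :=
  (\sum_(V : nesub n) m (enum_rank V) * #|val V|)%N.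

Fact Rweight0 n : @Rweight n 0%MM = 0%N.
Proof. by rewrite /Rweight big1 // => V _; rewrite mnm0E. Qed.
Fact RweightD n : {morph @Rweight n : m1 m2 / (m1 + m2)%MM >-> (m1 + m2)%N}.
Proof.
by move=> m1 m2; rewrite /Rweight -big_split; apply: eq_bigr => V _; rewrite mnmDE mulnDl.
Qed.
HB.instance Definition _ n := mpoly.isMeasure.Build #|nesub n| (@Rweight n) (@Rweight0 n) (@RweightD n).

Definition face (I J : Type) (k : I + J) : bool := if k is inl _ then true else false.

Definition chi_of (I J : Type) n (alpha : 'I_n -> I + J) : 'I_n -> bool := fun k => face (alpha k).

Definition Rpoly (I J : Type) n (alpha : 'I_n -> I + J) : {mpoly K[#|nesub n|]} :=
  \sum_(pi in BNC (chi_of alpha))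
    (muBNC (chi_of alpha) pi (one_part n))%:~R *: \prod_(V : nesub n | val V \in pi) Rindet V.

(* The product over [k < n] is taken in increasing order of [k]. *)
Definition Reval (A : algType K) (phi : A -> K) (I J : Type) n (alpha : 'I_n -> I + J) (z : I + J -> A) : K :=
  (Rpoly alpha).@[fun i => phi (\prod_(k < n | k \in val (enum_val i : nesub n)) z (alpha k))].
End RPolynomial.

(* [malg S K] is the vector space with basis S; [presented rel] is its quotient by
   the subspace spanned by [rel]. *)
Section LinearExtension.
Variables (K : fieldType) (S : choiceType) (Y : lmodType K).
Implicit Types (f : S -> Y) (g : malg S K).

Definition fgen (s : S) : malg S K := mkmalgU s 1.

Definition linext f g : Y := \sum_(s <- enum_fset (msupp g)) mcoeff s g *: f s.

Lemma linextE f g (d : seq S) : uniq d -> {subset msupp g <= d} ->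
  linext f g = \sum_(s <- d) mcoeff s g *: f s.
Proof.
move=> ud sd.
rewrite (bigID (mem (msupp g))) /= [X in _ + X]big1 ?addr0; last first.
  by move=> s; rewrite -mcoeff_eq0 => /eqP ->; rewrite scale0r.
rewrite -big_filter; apply: perm_big; apply: uniq_perm.
- exact: fset_uniq.
- exact: filter_uniq.
by move=> s; rewrite mem_filter; apply/idP/andP => [h|[]//]; split=> //; apply: sd.
Qed.

Fact linext_is_linear f : linear (linext f).
Proof.
move=> c u v; set d := undup (enum_fset (msupp u) ++ enum_fset (msupp v)
  ++ enum_fset (msupp (c *: u + v))).
have ud : uniq d := undup_uniq _.
rewrite !(@linextE _ _ d) //; try by move=> s; rewrite mem_undup !mem_cat => ->; rewrite ?orbT.
rewrite scaler_sumr -big_split; apply: eq_bigr => s _ /=.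
by rewrite mcoeffD mcoeffZ scalerDl scalerA.
Qed.
HB.instance Definition _ f := GRing.isLinear.Build K _ _ _ (linext f) (linext_is_linear f).

Lemma linext_gen f s : linext f (fgen s) = f s.
Proof.
rewrite (@linextE _ _ [:: s]) // ?big_seq1 ?mcoeffUU ?scale1r //.
by move=> t; rewrite msuppU oner_eq0 inE => /eqP ->; rewrite mem_head.
Qed.

Lemma fgen_ext (h h' : {linear malg S K -> Y}) :
  (forall s, h (fgen s) = h' (fgen s)) -> h =1 h'.
Proof.
move=> hh g; rewrite [g]monalgE !linear_sum; apply: eq_bigr => s _.
have -> : mkmalgU s (mcoeff s g) = mcoeff s g *: fgen s.
  by apply/malgP => t; rewrite mcoeffZ !mcoeffU; case: eqP => _; rewrite ?mulr1 ?mulr0.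
by rewrite !linearZ /= hh.
Qed.
End LinearExtension.

Section Presented.
Local Open Scope quotient_scope.
Variables (K : fieldType) (S : choiceType) (rel : malg S K -> Prop).
Implicit Types (u v : malg S K).

Inductive rel_span : malg S K -> Prop :=
  | rel_span_gen u of rel u : rel_span u
  | rel_span0 : rel_span 0
  | rel_span_comb c u v of rel_span u & rel_span v : rel_span (c *: u + v).

Definition spanb : {pred malg S K} := fun u => `[< rel_span u >].

Fact spanb_zmod_closed : zmod_closed spanb.
Proof.
split=> [|u v /asboolP hu /asboolP hv]; apply/asboolP; first exact: rel_span0.
by rewrite -[u - v]addrC -scaleN1r; apply: rel_span_comb.
Qed.
HB.instance Definition _ := GRing.isZmodClosed.Build _ spanb spanb_zmod_closed.

Definition presented : Type := Quotient.quot spanb.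
HB.instance Definition _ := GRing.Zmodule.on presented.

Definition pclass (u : malg S K) : presented := \pi_(Quotient.quot spanb) u.
Definition prepr (q : presented) : malg S K := repr (q : Quotient.quot spanb).

Lemma preprK : cancel prepr pclass. Proof. exact: reprK. Qed.

Lemma pclass_eq u v : rel_span (u - v) -> pclass u = pclass v.
Proof.
by move=> h; apply/eqP; rewrite -Quotient.idealrBE; apply/asboolP.
Qed.

Lemma pclass_span u v : pclass u = pclass v -> rel_span (u - v).
Proof.
by move/eqP; rewrite -Quotient.idealrBE => /asboolP.
Qed.

Lemma pclassD u v : pclass (u + v) = pclass u + pclass v.
Proof. exact: (raddfD (\pi_(Quotient.quot spanb))). Qed.

Definition pscale (c : K) (q : presented) : presented := pclass (c *: prepr q).

Lemma pclassZ c u : pclass (c *: u) = pscale c (pclass u).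
Proof.
apply: pclass_eq; rewrite -scalerBr -[_ *: _]addr0; apply: rel_span_comb.
  by apply: pclass_span; rewrite preprK.
exact: rel_span0.
Qed.

Fact pscaleA a b q : pscale a (pscale b q) = pscale (a * b) q.
Proof. by rewrite -[q]preprK -!pclassZ scalerA. Qed.
Fact pscale1 : left_id 1 pscale.
Proof. by move=> q; rewrite -[q]preprK -!pclassZ scale1r. Qed.
Fact pscaleDr : right_distributive pscale +%R.
Proof.
by move=> c q r; rewrite -[q]preprK -[r]preprK -pclassD -!pclassZ -pclassD scalerDr.
Qed.
Fact pscaleDl q : {morph pscale^~ q : a b / a + b}.
Proof. by move=> a b; rewrite -[q]preprK -!pclassZ -pclassD scalerDl. Qed.

HB.instance Definition _ := GRing.Zmodule_isLmodule.Build K presented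
  pscaleA pscale1 pscaleDr pscaleDl.

Fact pclass_is_linear : linear pclass.
Proof. by move=> c u v; rewrite pclassD pclassZ. Qed.
HB.instance Definition _ := GRing.isLinear.Build K _ _ _ pclass pclass_is_linear.

Definition pgen (s : S) : presented := pclass (fgen K s).

Lemma pclass0 u : rel u -> pclass u = 0.
Proof.
move=> h; rewrite -[RHS](raddf0 pclass); apply: pclass_eq; rewrite subr0.
exact: rel_span_gen.
Qed.

Lemma pgen_ext (Y : lmodType K) (h h' : {linear presented -> Y}) :
  (forall s, h (pgen s) = h' (pgen s)) -> h =1 h'.
Proof.
move=> hh q; rewrite -[q]preprK.
exact: (@fgen_ext _ _ _ (h \o pclass) (h' \o pclass)).
Qed.

Section Lift.
Variables (Y : lmodType K) (f : S -> Y).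
Hypothesis f_rel : forall u, rel u -> linext f u = 0.

Definition plift of (forall u, rel u -> linext f u = 0) : presented -> Y :=
  fun q => linext f (prepr q).

Lemma plift_class u : plift f_rel (pclass u) = linext f u.
Proof.
apply/eqP; rewrite -subr_eq0 -linearB; apply/eqP.
have : rel_span (prepr (pclass u) - u) by apply: pclass_span; rewrite preprK.
elim=> [r /f_rel //||c r s _ hr _ hs]; first by rewrite linear0.
by rewrite linearP /= hr hs scaler0 addr0.
Qed.

Fact plift_is_linear : linear (plift f_rel).
Proof.
move=> c u v; rewrite -[u]preprK -[v]preprK -linearP !plift_class.
exact: linearP.
Qed.
HB.instance Definition _ := GRing.isLinear.Build K _ _ _ (plift f_rel) plift_is_linear.

Lemma plift_gen s : plift f_rel (pgen s) = f s.
Proof. by rewrite plift_class linext_gen. Qed.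
End Lift.
End Presented.

(* Algebraic tensor product of (possibly infinite-dimensional) vector spaces. *)
Section Tensor.
Variables (K : fieldType) (U V : lmodType K).

Variant bilin_rel : malg (U * V)%type K -> Prop :=
  | bilin_rel_l c u1 u2 v :
      bilin_rel (fgen K (c *: u1 + u2, v) - c *: fgen K (u1, v) - fgen K (u2, v))
  | bilin_rel_r c u v1 v2 :
      bilin_rel (fgen K (u, c *: v1 + v2) - c *: fgen K (u, v1) - fgen K (u, v2)).

Definition tensor : Type := presented bilin_rel.
HB.instance Definition _ := GRing.Lmodule.on tensor.

Definition tens (u : U) (v : V) : tensor := pgen bilin_rel (u, v).

Lemma tens_linl v : linear (tens^~ v).
Proof.
move=> c u1 u2; apply/eqP; rewrite -subr_eq0 opprD addrA; apply/eqP.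
rewrite /tens /pgen -linearZ -!linearB; apply: pclass0; exact: bilin_rel_l.
Qed.

Lemma tens_linr u : linear (tens u).
Proof.
move=> c v1 v2; apply/eqP; rewrite -subr_eq0 opprD addrA; apply/eqP.
rewrite /tens /pgen -linearZ -!linearB; apply: pclass0; exact: bilin_rel_r.
Qed.
HB.instance Definition _ u := GRing.isLinear.Build K _ _ _ (tens u) (tens_linr u).

Lemma tens_ext (Y : lmodType K) (h h' : {linear tensor -> Y}) :
  (forall u v, h (tens u v) = h' (tens u v)) -> h =1 h'.
Proof. by move=> hh; apply: pgen_ext => -[u v]; apply: hh. Qed.

Section Lift.
Variables (Y : lmodType K) (f : U -> V -> Y).
Hypothesis fl : forall v, linear (f^~ v).
Hypothesis fr : forall u, linear (f u).

Fact tlift_rel r : bilin_rel r -> linext (fun p => f p.1 p.2) r = 0.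
Proof.
case=> *; rewrite !linearB linearZ /= !linext_gen /=.
  by rewrite fl addrAC addrK subrr.
by rewrite fr addrAC addrK subrr.
Qed.

Definition tlift : tensor -> Y := plift tlift_rel.
HB.instance Definition _ := GRing.Linear.on tlift.

Lemma tlift_tens u v : tlift (tens u v) = f u v.
Proof. exact: plift_gen. Qed.
End Lift.
End Tensor.

Section TensorMap.
Variables (K : fieldType) (U V U' V' : lmodType K).
Variables (S : {linear U -> U'}) (T : {linear V -> V'}).

Fact tmap_linl v : linear (fun u => tens (S u) (T v)).
Proof. by move=> c u1 u2; rewrite linearP tens_linl. Qed.
Fact tmap_linr u : linear (fun v => tens (S u) (T v)).
Proof. by move=> c v1 v2; rewrite !linearP. Qed.

Definition tmap : tensor U V -> tensor U' V' := tlift tmap_linl tmap_linr.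
HB.instance Definition _ := GRing.Linear.on tmap.

Lemma tmapE u v : tmap (tens u v) = tens (S u) (T v).
Proof. exact: tlift_tens. Qed.
End TensorMap.

(* Vector space with specified state-vector: [pv_proj] is a projection onto the
   line of [pv_xi], and the distinguished complement X° is its kernel. *)
Record pvspace (K : fieldType) := PVSpace {
  pv_sort :> lmodType K;
  pv_xi : pv_sort;
  pv_proj : {linear pv_sort -> pv_sort};
  pv_xi_neq0 : pv_xi != 0;
  pv_proj_xi : pv_proj pv_xi = pv_xi;
  pv_proj_line : forall x, exists c, pv_proj x = c *: pv_xi }.

Section PVTheory.
Variables (K : fieldType) (X : pvspace K).
Local Notation xi := (pv_xi X).

(* x = pv_coef x *: xi + ker_part x, with [ker_part x] in X°. *)
Definition pv_coef (x : X) : K := projT1 (cid (pv_proj_line x)).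

Lemma pv_projE x : pv_proj X x = pv_coef x *: xi.
Proof. exact: projT2 (cid (pv_proj_line x)). Qed.

Lemma pv_scale_inj : injective (fun c : K => c *: xi).
Proof.
move=> a b /eqP; rewrite -subr_eq0 -scalerBl scaler_eq0 subr_eq0.
by rewrite (negbTE (pv_xi_neq0 X)) orbF => /eqP.
Qed.

Fact pv_coef_is_linear : scalar pv_coef.
Proof.
move=> c x y; apply: pv_scale_inj; rewrite -pv_projE linearP /= !pv_projE.
by rewrite scalerA -scalerDl.
Qed.
HB.instance Definition _ := GRing.isLinear.Build K X K *%R pv_coef pv_coef_is_linear.

Lemma pv_coef_xi : pv_coef xi = 1.
Proof. by apply: pv_scale_inj; rewrite -pv_projE pv_proj_xi scale1r. Qed.

Definition ker_part (x : X) : X := x - pv_proj X x.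

Fact ker_part_is_linear : linear ker_part.
Proof.
by move=> c x y; rewrite /ker_part linearP scalerBr opprD addrACA.
Qed.
HB.instance Definition _ := GRing.isLinear.Build K _ _ _ ker_part ker_part_is_linear.

Lemma pv_proj_ker_part x : pv_proj X (ker_part x) = 0.
Proof. by rewrite linearB /= pv_projE linearZ /= pv_proj_xi subrr. Qed.

Lemma pv_decomp x : pv_coef x *: xi + ker_part x = x.
Proof. by rewrite -pv_projE addrC subrK. Qed.

Lemma pv_coef0 x : pv_proj X x = 0 -> pv_coef x = 0.
Proof. by move=> h; apply: pv_scale_inj; rewrite -pv_projE h scale0r. Qed.

Lemma ker_part_id x : pv_proj X x = 0 -> ker_part x = x.
Proof. by rewrite /ker_part => ->; rewrite subr0. Qed.

Lemma ker_part_xi : ker_part xi = 0.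
Proof. by rewrite /ker_part pv_proj_xi subrr. Qed.

(* By [pv_projE], p (T xi) = vstate T *: xi. *)
Definition vstate (T : X -> X) : K := pv_coef (T xi).
End PVTheory.

(* The two spaces are [X false] and [X true].  The sum over alternating
   d_1, ..., d_m of the tensor products X°^{d_1} (x) ... (x) X°^{d_m}, restricted
   to the summands whose index sequence satisfies P, is presented by the words
   (d_1,x_1) ... (d_m,x_m) of elements of the X°^{d_t} modulo linearity in each
   letter.  The empty word spans the summand C xi. *)
Section FreeProduct.
Variables (K : fieldType) (X : bool -> pvspace K).

Definition letter : Type := {d : bool & X d}.
HB.instance Definition _ := Choice.on letter.

Definition ltr (d : bool) (x : X d) : letter := existT (fun d => X d : Type) d x.

Definition in_ker (a : letter) : bool := pv_proj (X (tag a)) (tagged a) == 0.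

Definition is_word (P : pred (seq bool)) (s : seq letter) : bool :=
  [&& sorted (fun d d' => d != d') (map tag s), all in_ker s & P (map tag s)].

Definition word (P : pred (seq bool)) : Type := {s : seq letter | is_word P s}.
HB.instance Definition _ P := Choice.on (word P).
HB.instance Definition _ P := SubType.on (word P).

Variant multilin_rel (P : pred (seq bool)) : malg (word P) K -> Prop :=
  MultilinRel (u v : seq letter) (d : bool) (c : K) (x y : X d) (w wx wy : word P) of
    val w = u ++ ltr (c *: x + y) :: v & val wx = u ++ ltr x :: v & val wy = u ++ ltr y :: v :
  multilin_rel (fgen K w - c *: fgen K wx - fgen K wy).

Definition altsum (P : pred (seq bool)) : Type := presented (@multilin_rel P).
HB.instance Definition _ P := GRing.Lmodule.on (altsum P).

(* x_1 (x) ... (x) x_m; the value 0 on invalid words is never used. *)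
Definition wtens (P : pred (seq bool)) (s : seq letter) : altsum P :=
  if insub s is Some w then pgen (@multilin_rel P) w else 0.

Definition multilin (P : pred (seq bool)) (Y : lmodType K) (f : seq letter -> Y) : Prop :=
  forall u v d c (x y : X d), is_word P (u ++ ltr (c *: x + y) :: v) ->
    is_word P (u ++ ltr x :: v) -> is_word P (u ++ ltr y :: v) ->
    f (u ++ ltr (c *: x + y) :: v) = c *: f (u ++ ltr x :: v) + f (u ++ ltr y :: v).

Lemma wtens_val P (w : word P) : wtens P (val w) = pgen (@multilin_rel P) w.
Proof. by rewrite /wtens valK. Qed.

Lemma wtens_multilin P : multilin P (wtens P).
Proof.
move=> u v d c x y w1 w2 w3.
rewrite /wtens !insubT /=.
apply/eqP; rewrite -subr_eq0 opprD addrA; apply/eqP.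
rewrite /pgen -linearZ -!linearB; apply: pclass0.
exact: (@MultilinRel P u v d c x y).
Qed.

Lemma wtens_ext P (Y : lmodType K) (h h' : {linear altsum P -> Y}) :
  (forall s, is_word P s -> h (wtens P s) = h' (wtens P s)) -> h =1 h'.
Proof. by move=> hh; apply: pgen_ext => w; rewrite -wtens_val; apply: hh; apply: valP. Qed.

Section Lift.
Variables (P : pred (seq bool)) (Y : lmodType K) (f : seq letter -> Y).
Hypothesis fP : multilin P f.

Fact altlift_rel r : multilin_rel r -> linext (fun w : word P => f (val w)) r = 0.
Proof.
case=> u v d c x y w wx wy ew ewx ewy.
rewrite !linearB linearZ /= !linext_gen ew ewx ewy fP -?ew -?ewx -?ewy; try exact: valP.
by rewrite addrAC addrK subrr.
Qed.

Definition altlift : altsum P -> Y := plift altlift_rel.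
HB.instance Definition _ := GRing.Linear.on altlift.

Lemma altlift_wtens s : is_word P s -> altlift (wtens P s) = f s.
Proof. by move=> h; rewrite /wtens insubT /altlift plift_gen. Qed.
End Lift.

Definition fp_space : Type := altsum predT.
HB.instance Definition _ := GRing.Lmodule.on fp_space.

Definition fp_xi : fp_space := wtens predT [::].

Fact fp_proj_multilin :
  multilin predT (fun s => if s is [::] then fp_xi else 0).
Proof. by case=> [|a u] v d c x y _ _ _ /=; rewrite scaler0 addr0. Qed.

Definition fp_proj : fp_space -> fp_space := altlift fp_proj_multilin.
HB.instance Definition _ := GRing.Linear.on fp_proj.

Fact fp_coef_multilin :
  @multilin predT K^o (fun s => if s is [::] then 1 else 0).
Proof. by case=> [|a u] v d c x y _ _ _ /=; rewrite scaler0 addr0. Qed.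

Fact fp_xi_neq0 : fp_xi != 0.
Proof.
apply/eqP => /(congr1 (altlift fp_coef_multilin)).
by rewrite linear0 altlift_wtens // => /eqP; rewrite oner_eq0.
Qed.

Lemma fp_proj_wtens s : is_word predT s ->
  fp_proj (wtens predT s) = if s is [::] then fp_xi else 0.
Proof. exact: altlift_wtens. Qed.

Fact fp_proj_xi : fp_proj fp_xi = fp_xi.
Proof. exact: fp_proj_wtens. Qed.

Fact fp_proj_line x : exists c, fp_proj x = c *: fp_xi.
Proof.
exists (altlift fp_coef_multilin x : K).
have lin : linear (fun x => (altlift fp_coef_multilin x : K) *: fp_xi).
  by move=> c u v; rewrite linearP scalerDl scalerA.
pose h : {linear fp_space -> fp_space} := HB.pack (fun x => (altlift fp_coef_multilin x : K) *: fp_xi)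
  (GRing.isLinear.Build K _ _ _ _ lin).
suff e : fp_proj =1 h by exact: e.
apply: wtens_ext => s hs.
by rewrite [LHS]fp_proj_wtens // /h /= altlift_wtens //; case: s {hs} => [|? ?]; rewrite ?scale1r ?scale0r.
Qed.

Definition free_product : pvspace K :=
  PVSpace fp_xi_neq0 fp_proj_xi fp_proj_line.

End FreeProduct.

Section LmodAux.
Variables (K : fieldType) (V : lmodType K) (a b c : K) (A B C D : V).
Lemma lmod_aux : a *: (c *: A + B) + (c *: C + D) = c *: (a *: A + C) + (a *: B + D).
Proof. by rewrite !scalerDr !scalerA mulrC addrACA. Qed.
Lemma lmod_aux2 : a *: (c *: A) + B + (a *: C + D) = c *: (a *: A) + a *: C + (B + D).
Proof. by rewrite !scalerA mulrC addrACA. Qed.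
Lemma lmod_aux3 : (c * a + b) *: A + (c *: B + C) = c *: (a *: A + B) + (b *: A + C).
Proof. by rewrite scalerDl scalerDr scalerA addrACA. Qed.
End LmodAux.

(* [altsum X lpred] is X(l,d): the summands with d_1 <> d, and the line of xi. *)
Section LeftAction.
Variables (K : fieldType) (X : bool -> pvspace K) (d : bool).
Local Notation FP := (free_product X).

Definition lpred : pred (seq bool) := fun w => head (~~ d) w != d.
Local Notation Xl := (altsum X lpred).

(* V_d (x (x) s) for a word s: xi (x) s |-> s and y (x) s |-> ys for y in X°^d. *)
Definition lglue (x : X d) (s : seq (letter X)) : FP :=
  pv_coef x *: wtens predT s + wtens predT (ltr (ker_part x) :: s).

Lemma lword_cons (x : X d) s : is_word lpred s ->
  is_word predT (ltr (ker_part x) :: s).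
Proof.
rewrite /is_word /in_ker /= pv_proj_ker_part eqxx andbT /lpred => /and3P[h1 -> h2].
rewrite andbT; move: h1 h2; case: (map tag s) => [|e t] //= -> /=.
by rewrite eq_sym !andbT.
Qed.

Lemma is_wordT P s : is_word P s -> is_word (X := X) predT s.
Proof. by rewrite /is_word => /and3P[-> ->]. Qed.

Fact lglue_multilin x : multilin lpred (lglue x).
Proof.
move=> u v e c y z w wy wz; rewrite /lglue.
have h := @wtens_multilin K X predT (ltr (ker_part x) :: u) v e c y z.
rewrite /= in h; rewrite h; try exact: lword_cons.
by rewrite wtens_multilin; [exact: lmod_aux | exact: is_wordT w | exact: is_wordT wy | exact: is_wordT wz].
Qed.

Definition lmap (x : X d) : Xl -> FP := altlift (lglue_multilin x).
HB.instance Definition _ x := GRing.Linear.on (lmap x).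

Lemma lmap_wtens x s : is_word lpred s -> lmap x (wtens lpred s) = lglue x s.
Proof. exact: altlift_wtens. Qed.

Fact lmap_linl y : linear (lmap ^~ y).
Proof.
move=> c x1 x2.
pose g y := c *: lmap x1 y + lmap x2 y.
have lin : linear g.
  move=> a u v; rewrite /g !linearP /=. exact: lmod_aux2.
pose h : {linear Xl -> FP} := HB.pack g (GRing.isLinear.Build K _ _ _ _ lin).
suff e : lmap (c *: x1 + x2) =1 h by exact: e.
apply: wtens_ext => s ws; rewrite [LHS]lmap_wtens // /h /= /g !lmap_wtens // /lglue.
rewrite linearP /= linearP.
have := @wtens_multilin K X predT [::] s d c (ker_part x1) (ker_part x2).
rewrite /= -linearP => ->; try exact: lword_cons.
exact: lmod_aux3.
Qed.

Fact lmap_linr x : linear (lmap x). Proof. exact: linearP. Qed.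

Definition Vmap : tensor (X d) Xl -> FP := tlift lmap_linl lmap_linr.
HB.instance Definition _ := GRing.Linear.on Vmap.

Lemma Vmap_tens x s : is_word lpred s -> Vmap (tens x (wtens lpred s)) = lglue x s.
Proof. by move=> ws; rewrite -lmap_wtens // /Vmap tlift_tens. Qed.

Definition lcut (s : seq (letter X)) : tensor (X d) Xl :=
  if s is a :: s' then
    if tag a == d then tens (tagged_as (ltr (pv_xi (X d))) a) (wtens lpred s')
    else tens (pv_xi (X d)) (wtens lpred s)
  else tens (pv_xi (X d)) (wtens lpred [::]).

Lemma lcut_eq (x : X d) s : lcut (ltr x :: s) = tens x (wtens lpred s).
Proof. by rewrite /lcut /= eqxx tagged_asE. Qed.

Lemma lcut_neq s : lpred (map tag s) -> lcut s = tens (pv_xi (X d)) (wtens lpred s).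
Proof. by case: s => [|a s] //=; rewrite /lpred /= => /negbTE ->. Qed.

Lemma lword_tail a s : tag a = d -> is_word (X:=X) predT (a :: s) -> is_word lpred s.
Proof.
rewrite /is_word /lpred /= => -> /and3P[h /andP[_ ->] _] /=; move: h.
case: s => [|b s] /=; first by case: d.
by case/andP => h ->; rewrite eq_sym.
Qed.

Fact lcut_multilin : multilin predT lcut.
Proof.
case=> [|a u] v e c x y w wx wy.
  rewrite ![[::] ++ _]/=.
  case: (eqVneq e d) => [ed|ned].
    move: x y w wx wy; rewrite ed {e ed} => x y w wx wy.
    by rewrite !lcut_eq tens_linl.
  have l z : lpred (map tag (@ltr _ X e z :: v)) by rewrite /lpred /=.
  rewrite !lcut_neq //.
  have wl z : is_word predT (@ltr _ X e z :: v) -> is_word lpred (ltr z :: v).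
    by rewrite {2}/is_word l => /and3P[-> -> _].
  have := @wtens_multilin K X lpred [::] v e c x y (wl _ w) (wl _ wx) (wl _ wy).
  by move=> /= ->; rewrite linearP.
case: (eqVneq (tag a) d) => [ad|nad].
  case: a ad w wx wy => [a z] /= ad; move: z; rewrite ad => z w wx wy.
  rewrite eqxx !tagged_asE.
  rewrite wtens_multilin ?linearP //; by apply: lword_tail; [|eassumption].
have wl z : is_word predT ((a :: u) ++ @ltr _ X e z :: v) -> is_word lpred ((a :: u) ++ ltr z :: v).
  by rewrite /is_word => /and3P[-> -> _]; rewrite /lpred /= nad.
rewrite !lcut_neq; try by rewrite /lpred /=.
by rewrite wtens_multilin ?linearP //; exact: wl.
Qed.

Definition Vinv : FP -> tensor (X d) Xl := altlift lcut_multilin.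
HB.instance Definition _ := GRing.Linear.on Vinv.

Lemma Vinv_wtens s : is_word predT s -> Vinv (wtens predT s) = lcut s.
Proof. exact: altlift_wtens. Qed.

Lemma VmapK : cancel Vmap Vinv.
Proof.
suff e : (Vinv \o Vmap) =1 idfun by exact: e.
apply: tens_ext => x y.
have lin : linear (tens x : Xl -> tensor (X d) Xl) by exact: linearP.
suff e : (Vinv \o Vmap \o tens x) =1 tens x by exact: e.
apply: wtens_ext => s ws; rewrite /= Vmap_tens // /lglue linearD linearZ /=.
have /and3P[_ _ ls] := ws.
rewrite !Vinv_wtens; try exact: lword_cons; try exact: is_wordT ws.
rewrite lcut_eq lcut_neq //.
by rewrite -tens_linl pv_decomp.
Qed.

Lemma VinvK : cancel Vinv Vmap.
Proof.
suff e : (Vmap \o Vinv) =1 idfun by exact: e.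
apply: wtens_ext => s ws /=; rewrite Vinv_wtens //.
have [ls|] := boolP (lpred (map tag s)).
  rewrite lcut_neq // Vmap_tens; last by move: ws; rewrite /is_word ls => /and3P[-> ->].
  rewrite /lglue pv_coef_xi ker_part_xi scale1r.
  suff -> : wtens predT (ltr (0 : X d) :: s) = 0 by rewrite addr0.
  have w0 : is_word predT (ltr (0 : X d) :: s).
    by rewrite -(ker_part_xi (X d)); apply: lword_cons; move: ws; rewrite /is_word ls => /and3P[-> ->].
  have := @wtens_multilin K X predT [::] s d (-1) 0 0.
  by rewrite /= scaler0 addr0 => /(_ w0 w0 w0); rewrite scaleN1r addNr.
case: s ws => [|a s] ws; first by move/negP; case; rewrite /lpred /=; case: (d).
rewrite /lpred /= negbK => /eqP ad.
case: a ad ws => [a z] /= ad; move: z; rewrite ad => z ws.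
rewrite eqxx tagged_asE Vmap_tens; last exact: lword_tail ws.
have hz : pv_proj (X d) z = 0 by move: ws; rewrite /is_word /in_ker /= => /and3P[_ /andP[/eqP]].
by rewrite /lglue pv_coef0 // ker_part_id // scale0r add0r.
Qed.

(* V_d (T (x) 1) V_d^{-1}; see [VmapK] and [VinvK]. *)
Definition lambda_act (T : {linear X d -> X d}) : FP -> FP :=
  Vmap \o tmap T idfun \o Vinv.
HB.instance Definition _ T := GRing.Linear.on (lambda_act T).

Lemma lambda_act_Vmap T u : lambda_act T (Vmap u) = Vmap (tmap T idfun u).
Proof. by rewrite /lambda_act /= VmapK. Qed.

End LeftAction.

(* [altsum X rpred] is X(r,d): the summands with d_m <> d, and the line of xi. *)
Section RightAction.
Variables (K : fieldType) (X : bool -> pvspace K) (d : bool).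
Local Notation FP := (free_product X).

Definition rpred : pred (seq bool) := fun w => last (~~ d) w != d.
Local Notation Xr := (altsum X rpred).

(* W_d (s (x) x) for a word s. *)
Definition rglue (x : X d) (s : seq (letter X)) : FP :=
  pv_coef x *: wtens predT s + wtens predT (rcons s (ltr (ker_part x))).

Lemma is_word_rcons P s (a : letter X) :
  is_word P (rcons s a) =
  [&& is_word predT s, last (~~ tag a) (map tag s) != tag a, in_ker a & P (rcons (map tag s) (tag a))].
Proof.
rewrite /is_word map_rcons all_rcons /= andbT.
case: s => [|b s] /=; first by rewrite andbT; case: (tag a).
rewrite rcons_path last_map.
by move: (path _ _ _) (_ != _) (in_ker a) (in_ker b && _) (P _) => [] [] [] [] [].
Qed.

Lemma rword_rcons (x : X d) s : is_word rpred s ->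
  is_word predT (rcons s (ltr (ker_part x))).
Proof.
rewrite is_word_rcons /in_ker /= pv_proj_ker_part eqxx => ws.
rewrite (is_wordT ws) andbT /=.
by rewrite andbT; case/and3P: ws.
Qed.

Fact rglue_multilin x : multilin rpred (rglue x).
Proof.
move=> u v e c y z w wy wz; rewrite /rglue.
have h := @wtens_multilin K X predT u (rcons v (ltr (ker_part x))) e c y z.
rewrite !rcons_cat !rcons_cons h -?rcons_cons -?rcons_cat; try exact: rword_rcons.
by rewrite wtens_multilin; [exact: lmod_aux | exact: is_wordT w | exact: is_wordT wy | exact: is_wordT wz].
Qed.

Definition rmap (x : X d) : Xr -> FP := altlift (rglue_multilin x).
HB.instance Definition _ x := GRing.Linear.on (rmap x).

Lemma rmap_wtens x s : is_word rpred s -> rmap x (wtens rpred s) = rglue x s.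
Proof. exact: altlift_wtens. Qed.

Fact rmap_linr y : linear (rmap ^~ y).
Proof.
move=> c x1 x2.
pose g y := c *: rmap x1 y + rmap x2 y.
have lin : linear g.
  by move=> a u v; rewrite /g !linearP /=; exact: lmod_aux2.
pose h : {linear Xr -> FP} := HB.pack g (GRing.isLinear.Build K _ _ _ _ lin).
suff e : rmap (c *: x1 + x2) =1 h by exact: e.
apply: wtens_ext => s ws; rewrite [LHS]rmap_wtens // /h /= /g !rmap_wtens // /rglue.
rewrite linearP /= linearP.
have := @wtens_multilin K X predT s [::] d c (ker_part x1) (ker_part x2).
rewrite !cats1 -linearP => ->; try exact: rword_rcons.
exact: lmod_aux3.
Qed.

Fact rmap_linl x : linear (rmap x). Proof. exact: linearP. Qed.

Definition Wmap : tensor Xr (X d) -> FP :=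
  tlift (f := fun y x => rmap x y) rmap_linl rmap_linr.
HB.instance Definition _ := GRing.Linear.on Wmap.

Lemma Wmap_tens x s : is_word rpred s -> Wmap (tens (wtens rpred s) x) = rglue x s.
Proof. by move=> ws; rewrite -rmap_wtens // /Wmap tlift_tens. Qed.

Definition rcut (s : seq (letter X)) : tensor Xr (X d) :=
  if s is a :: s' then
    if tag (last a s') == d then
      tens (wtens rpred (belast a s')) (tagged_as (ltr (pv_xi (X d))) (last a s'))
    else tens (wtens rpred s) (pv_xi (X d))
  else tens (wtens rpred [::]) (pv_xi (X d)).

Lemma rcut_eq (x : X d) s : rcut (rcons s (ltr x)) = tens (wtens rpred s) x.
Proof.
case: s => [|a s]; first by rewrite /rcut /= eqxx tagged_asE.
by rewrite /rcut rcons_cons last_rcons eqxx tagged_asE belast_rcons.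
Qed.

Lemma rcut_neq s : rpred (map tag s) -> rcut s = tens (wtens rpred s) (pv_xi (X d)).
Proof. by case: s => [|a s] //=; rewrite /rpred /= last_map => /negbTE ->. Qed.


Lemma rword_belast a s : tag a = d -> is_word (X:=X) predT (rcons s a) -> is_word rpred s.
Proof.
by move=> ad; rewrite is_word_rcons ad => /and4P[/and3P[h1 h2 _] h3 _ _]; rewrite /is_word h1 h2.
Qed.

Lemma tag_last_ltr (b : letter X) : tag b = d -> exists x : X d, b = ltr x.
Proof. by case: b => e x /= ed; move: x; rewrite ed => x; exists x. Qed.

Lemma is_wordW s : is_word (X:=X) predT s -> rpred (map tag s) -> is_word rpred s.
Proof. by rewrite /is_word => /and3P[-> -> _]. Qed.

Fact rcut_multilin : multilin predT rcut.
Proof.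
move=> u v; case: (lastP v) => [|v' b] e c x y; rewrite -?rcons_cons -?rcons_cat ?cats1 => w wx wy.
  case: (eqVneq e d) => [ed|ned].
    move: x y w wx wy; rewrite ed {e ed} => x y w wx wy.
    by rewrite !rcut_eq linearP.
  have l z : rpred (map tag (rcons u (@ltr _ X e z))) by rewrite /rpred map_rcons last_rcons.
  rewrite !rcut_neq //.
  have := @wtens_multilin K X rpred u [::] e c x y; rewrite !cats1.
  by move=> ->; rewrite ?tens_linl //; apply: is_wordW.
case: (eqVneq (tag b) d) => [bd|nbd].
  have [z eb] := tag_last_ltr bd; rewrite {}eb in w wx wy *.
  rewrite !rcut_eq wtens_multilin ?tens_linl //; by apply: rword_belast; [|eassumption].
have l s : rpred (map tag (rcons s b)) by rewrite /rpred map_rcons last_rcons.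
rewrite !rcut_neq // !rcons_cat !rcons_cons.
rewrite wtens_multilin ?tens_linl // -?rcons_cons -?rcons_cat; exact: is_wordW.
Qed.

Definition Winv : FP -> tensor Xr (X d) := altlift rcut_multilin.
HB.instance Definition _ := GRing.Linear.on Winv.

Lemma Winv_wtens s : is_word predT s -> Winv (wtens predT s) = rcut s.
Proof. exact: altlift_wtens. Qed.

Lemma WmapK : cancel Wmap Winv.
Proof.
suff e : (Winv \o Wmap) =1 idfun by exact: e.
apply: tens_ext => y x.
have lin : linear (fun y : Xr => tens y x) by exact: tens_linl.
pose h : {linear Xr -> tensor Xr (X d)} := HB.pack (fun y : Xr => tens y x)
  (GRing.isLinear.Build K _ _ _ _ lin).
suff e : (Winv \o Wmap \o h) =1 h by exact: e.
apply: wtens_ext => s ws; rewrite /= Wmap_tens // /rglue linearD linearZ /=.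
have /and3P[_ _ ls] := ws.
rewrite !Winv_wtens; try exact: rword_rcons; try exact: is_wordT ws.
by rewrite rcut_eq rcut_neq // -linearP pv_decomp.
Qed.

Lemma WinvK : cancel Winv Wmap.
Proof.
suff e : (Wmap \o Winv) =1 idfun by exact: e.
apply: wtens_ext => s ws /=; rewrite Winv_wtens //.
have [ls|] := boolP (rpred (map tag s)).
  rewrite rcut_neq // Wmap_tens; last exact: is_wordW.
  rewrite /rglue pv_coef_xi ker_part_xi scale1r.
  suff -> : wtens predT (rcons s (ltr (0 : X d))) = 0 by rewrite addr0.
  have w0 : is_word predT (rcons s (ltr (0 : X d))).
    by rewrite -(ker_part_xi (X d)); apply: rword_rcons; exact: is_wordW.
  have := @wtens_multilin K X predT s [::] d (-1) 0 0.
  by rewrite !cats1 scaler0 addr0 => /(_ w0 w0 w0); rewrite scaleN1r addNr.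
case: (lastP s) ws => [|{}s b] ws; first by move/negP; case; rewrite /rpred /=; case: (d).
rewrite /rpred map_rcons last_rcons negbK => /eqP bd.
have [z eb] := tag_last_ltr bd; rewrite {b bd}eb in ws *.
rewrite rcut_eq Wmap_tens; last exact: rword_belast ws.
have hz : pv_proj (X d) z = 0.
  by move: ws; rewrite is_word_rcons => /and4P[_ _ /eqP].
by rewrite /rglue pv_coef0 // ker_part_id // scale0r add0r.
Qed.

(* W_d (1 (x) T) W_d^{-1}; see [WmapK] and [WinvK]. *)
Definition rho_act (T : {linear X d -> X d}) : FP -> FP :=
  Wmap \o tmap idfun T \o Winv.
HB.instance Definition _ T := GRing.Linear.on (rho_act T).

Lemma rho_act_Wmap T u : rho_act T (Wmap u) = Wmap (tmap idfun T u).
Proof. by rewrite /rho_act /= WmapK. Qed.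
End RightAction.

Section BiFree.
Variables (K : fieldType) (I J : Type).

(* [malg (fmonom {classic I}) K] is the algebra of non-commutative polynomials
   over [K] in formal variables indexed by [I]; [{classic I}] is [I] with its
   classical choice structure. *)
Definition ncpoly (I : Type) : lalgType K := malg (fmonom {classic I}) K.

Definition ncvar (I : Type) (i : I) : ncpoly I := mkmalgU (fmu (i : {classic I})) 1.

(* Unital algebra homomorphisms into L(X). *)
Definition unital_hom (I : Type) (X : lmodType K) (h : ncpoly I -> {linear X -> X}) : Prop :=
  [/\ forall c f g x, h (c *: f + g) x = c *: h f x + h g x,
      forall x, h 1 x = x &
      forall f g x, h (f * g) x = h f (h g x)].

Section Model.
Variables (X : bool -> pvspace K).
Variables (l : forall d, ncpoly I -> {linear X d -> X d}).
Variables (r : forall d, ncpoly J -> {linear X d -> X d}).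

Definition model_op (d : bool) (k : I + J) : free_product X -> free_product X :=
  match k with
  | inl i => lambda_act (l d (ncvar i))
  | inr j => rho_act (r d (ncvar j))
  end.
End Model.

(* The index [(d, k)] in the word [w] stands for the [k]-th entry of the first
   family if [d = false], of the second one if [d = true]. *)
Definition bifree (A : algType K) (phi : A -> K) (z1 z2 : I + J -> A) : Prop :=
  exists (X : bool -> pvspace K)
         (l : forall d, ncpoly I -> {linear X d -> X d})
         (r : forall d, ncpoly J -> {linear X d -> X d}),
    [/\ forall d, unital_hom (l d), forall d, unital_hom (r d) &
        forall w : seq (bool * (I + J)),
          vstate (foldr (fun q T => model_op l r q.1 q.2 \o T) idfun w)
          = phi (\prod_(q <- w) (if q.1 then z2 else z1) q.2)].
End BiFree.

(* Main.v *)
Require Import Defs.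
From HB Require Import structures.
From mathcomp Require Import all_boot all_order all_fingroup all_algebra.
From mathcomp Require Import boolp reals complex.
From mathcomp.multinomials Require Import mpoly.
Import GRing.Theory.
Local Open Scope ring_scope.

Set Implicit Arguments.
Unset Strict Implicit.
Unset Printing Implicit Defensive.

(** The first claim holds because a partition [pi] contributes a single
    monomial, whose weight is the sum of the sizes of the blocks of [pi].

    The identity between [R_alpha (z)] and the cumulant is Moebius inversion.
    The moment of the entries indexed by a block [V] is the sum over the
    non-crossing partitions of [V] ([moment_cumulant_subset]).  The part of the
    lattice below [pi] is the product of the lattices of its blocks, so the
    product of these moments over the blocks of [pi] is the sum over all
    [rho <= pi] of the products of cumulants ([prod_ncpart]), and the Moebius
    function inverts this summation ([mobius_inversion]).

    Additivity follows by multilinearity once mixed cumulants of bi-free families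
    vanish ([mixed_cumulant]).  By induction on the length this amounts to: a
    mixed moment is the sum, over the bi-non-crossing partitions whose blocks have
    one colour (entries of one of the two families), of the products of cumulants
    ([model_mixed_moment]).  To prove this formula, call a family of vectors
    [E_S], indexed by sets of times [S], a Fock family for operators [T_i] and
    weights [wt] if, for [i] smaller than all elements of [S],
      [T_i E_S = E_(i,S) + sum_U wt (i,U) E_(S - U)],
    where [U] runs over the subsets of [S] adjacent to [i] in the order given by
    [s_chi]: initial segments if [i] is a left index, final ones if it is a right
    index.  The set [S] is a stack of open elements; applying [T_i] either puts [i]
    on the stack or closes a block [(i,U)].  Blocks closed in this way never cross,
    and every bi-non-crossing partition arises once; so the coefficient of
    [E_0], the vector of the empty stack, in [T_1 ... T_n E_0] is the sum over
    bi-non-crossing partitions of the products of weights ([fock_vacuum]).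

    For each colour [d] the defining relation can be solved for [E_(i,S)], which
    gives a Fock family in [X d] with [E_0 = xi] whose weights are the cumulants.
    Comparing the coefficient of [E_0] with the moment-cumulant formula shows that
    all other [E_S] lie in the kernel of the state ([family_vec_coef]), so that they
    are letters of the free product.  For a set [S] of mixed colours, read [S] in the
    order of [s_chi], cut it into maximal runs of one colour and take the tensor
    product of the vectors of the runs.  A left operator only changes the first
    run and a right operator only the last one, in the same way as on [X d];
    hence these tensors form a Fock family in the free product for the weights
    that vanish on sets of several colours ([mixed_fock]), and [fock_vacuum]
    gives the formula for mixed moments. *)

(** * Non-crossing partitions in the order of s_chi *)

Lemma ltn_ord_trans n : transitive (fun i j : 'I_n => (i < j)%N).
Proof. by move=> j i k; apply: ltn_trans. Qed.

Lemma sorted_enum_ord n (P : pred 'I_n) : sorted (fun i j : 'I_n => (i < j)%N) (enum P).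
Proof.
rewrite /enum_mem sorted_filter //; first exact: ltn_ord_trans.
by have := iota_ltn_sorted 0 n; rewrite -val_enum_ord sorted_map enumT.
Qed.

Section Position.
Variable n : nat.
Implicit Types (chi : 'I_n -> bool) (pi : {set {set 'I_n}}) (S : {set 'I_n}).

(** The order in which bi-non-crossing partitions of [chi] become non-crossing. *)
Definition pos chi (k : 'I_n) : nat := index k (s_seq chi).

Lemma mem_s_seq chi k : k \in s_seq chi.
Proof. by rewrite mem_cat mem_rev !mem_enum !inE orbN. Qed.

Lemma pos_perm chi k : (s_perm chi)^-1%g k = pos chi k :> nat.
Proof.
rewrite -{2}[k](permKV (s_perm chi)); move: ((s_perm chi)^-1%g k) => m.
rewrite permE /s_fun /pos (tnth_nth k) index_uniq ?uniq_s_seq //.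
by rewrite (eqP (size_s_seq chi)).
Qed.

Lemma pos_inj chi : injective (pos chi).
Proof. by move=> i j; rewrite -!pos_perm => /val_inj/perm_inj. Qed.

(** Together with injectivity, this determines the order given by [s_chi]. *)
Lemma pos_lt chi (i j : 'I_n) : (i < j)%N -> (pos chi i < pos chi j)%N = chi i.
Proof.
(* [r] is the order by which [s_seq] is sorted: left indices increasingly, then
   right indices decreasingly. *)
pose r (x y : 'I_n) := if chi x then (x < y)%N || ~~ chi y else ~~ chi y && (y < x)%N.
have r_tr : transitive r.
  move=> y x z; rewrite /r; case: (chi x); case: (chi y); case: (chi z); rewrite /= ?orbF ?orbT //.
    exact: ltn_trans.
  by move=> xy yz; apply: ltn_trans xy.
have s_enum (P : pred 'I_n) : pairwise (fun x y : 'I_n => (x < y)%N) (enum P).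
  by rewrite -sorted_pairwise; [exact: sorted_enum_ord | exact: ltn_ord_trans].
have r_sorted : sorted r (s_seq chi).
  rewrite sorted_pairwise // pairwise_cat; apply/and3P; split.
  - apply/allrelP => x y; rewrite mem_rev !mem_enum /r !inE => -> ->.
    by rewrite orbT.
  - apply: (sub_in_pairwise (P := chi)) (s_enum _).
      by move=> x y; rewrite !unfold_in => xP yP xy; rewrite /r xP xy.
    by apply/allP => x; rewrite mem_enum.
  rewrite -sorted_pairwise // rev_sorted sorted_pairwise; last first.
    by move=> y x z yx zy; apply: r_tr zy yx.
  apply: (sub_in_pairwise (P := predC chi)) (s_enum _).
    by move=> x y; rewrite !unfold_in => /negbTE xP /negbTE yP xy; rewrite /r xP yP.
  by apply/allP => x; rewrite mem_enum.
have posr (x y : 'I_n) : (pos chi x < pos chi y)%N -> r x y.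
  by move=> xy; apply: (sorted_ltn_index r_tr r_sorted); rewrite ?mem_s_seq.
move=> ij; case: ltngtP.
- move=> /posr; rewrite /r [(j < i)%N]ltnNge (ltnW ij) /=.
  by case: (chi i) => //; rewrite andbF.
- move=> /posr; rewrite /r [(j < i)%N]ltnNge (ltnW ij) /=.
  by case: (chi i) => //; rewrite if_same.
by move=> /pos_inj eij; rewrite eij ltnn in ij.
Qed.

Lemma pos_gt chi (i j : 'I_n) : (j < i)%N -> (pos chi i < pos chi j)%N = ~~ chi j.
Proof.
move=> ji; rewrite -(pos_lt chi ji) -leqNgt ltn_neqAle (inj_eq (@pos_inj chi)).
by rewrite -val_eqE (gtn_eqF ji).
Qed.

(** The [noncrossing] condition transported to the original indices, so that it
    makes sense for partitions of any subset without renumbering. *)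
Definition crossfree chi pi : bool :=
  [forall V in pi, forall W in pi, forall a in V, forall b in W, forall c in V, forall d in W,
     ((pos chi a < pos chi b)%N && (pos chi b < pos chi c)%N && (pos chi c < pos chi d)%N)
       ==> (V == W)].

Lemma crossfreeP chi pi :
  reflect (forall V W a b c d, V \in pi -> W \in pi -> a \in V -> b \in W -> c \in V -> d \in W ->
             (pos chi a < pos chi b)%N -> (pos chi b < pos chi c)%N -> (pos chi c < pos chi d)%N ->
             V = W)
          (crossfree chi pi).
Proof.
apply: (iffP idP) => [h V W a b c d Vp Wp aV bW cV dW ab bc cd|h].
  move/forall_inP: h => /(_ V Vp)/forall_inP/(_ W Wp)/forall_inP/(_ a aV)/forall_inP/(_ b bW).
  move=> /forall_inP/(_ c cV)/forall_inP/(_ d dW)/implyP.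
  by rewrite ab bc cd => /(_ isT)/eqP.
apply/forall_inP => V Vp; apply/forall_inP => W Wp; apply/forall_inP => a aV.
apply/forall_inP => b bW; apply/forall_inP => c cV; apply/forall_inP => d dW.
by apply/implyP => /andP[/andP[ab bc] cd]; rewrite (h V W a b c d).
Qed.

Definition ncpart chi S : {set {set {set 'I_n}}} := [set pi | partition pi S & crossfree chi pi].

Lemma BNC_ncpart chi : BNC chi = ncpart chi [set: 'I_n].
Proof.
apply/setP => pi; rewrite [LHS]in_set [RHS]in_set; congr (_ && _); set q := (s_perm chi)^-1%g.
apply/idP/crossfreeP => [h V W a b c d Vp Wp aV bW cV dW ab bc cd|h].
  have qm (U : {set 'I_n}) : U \in pi -> q @: U \in [set q @: U | U : {set 'I_n} in pi].
    by move=> Up; apply: imset_f.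
  move/forall_inP: h => /(_ _ (qm _ Vp))/forall_inP/(_ _ (qm _ Wp)).
  move=> /forall_inP/(_ _ (imset_f _ aV))/forall_inP/(_ _ (imset_f _ bW)).
  move=> /forall_inP/(_ _ (imset_f _ cV))/forall_inP/(_ _ (imset_f _ dW))/implyP.
  by rewrite !pos_perm ab bc cd => /(_ isT)/eqP/imset_inj-> //; apply: perm_inj.
apply/forall_inP => _ /imsetP[V Vp ->]; apply/forall_inP => _ /imsetP[W Wp ->].
apply/forall_inP => _ /imsetP[a aV ->]; apply/forall_inP => _ /imsetP[b bW ->].
apply/forall_inP => _ /imsetP[c cV ->]; apply/forall_inP => _ /imsetP[d dW ->].
rewrite !pos_perm; apply/implyP => /andP[/andP[ab bc] cd].
by rewrite (h V W a b c d).
Qed.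
End Position.

(** * The moment-cumulant formula on a subset *)

Section Moments.
Variables (K : fieldType) (A : algType K).
Implicit Types (F kappa : cumulant_family A).

Definition block_cumulant F n (chi : 'I_n -> bool) (a : 'I_n -> A) (V : {set 'I_n}) : K :=
  F #|V| (restr chi V) (restr a V).

Lemma cumulant_cast F p q (e : p = q) (chi : 'I_p -> bool) (a : 'I_p -> A) chi' a' :
  (forall t, chi t = chi' (cast_ord e t)) -> (forall t, a t = a' (cast_ord e t)) ->
  F p chi a = F q chi' a'.
Proof.
case: _ / e chi' a' => chi' a' hchi ha.
by congr (F _ _ _); apply/funext => t; rewrite ?hchi ?ha cast_ord_id.
Qed.

Lemma prod_enum n (S : {set 'I_n}) (a : 'I_n -> A) :
  \prod_(k < n | k \in S) a k = \prod_(k <- enum S) a k.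
Proof. by rewrite -[LHS]big_filter [index_enum _]unlock. Qed.

Section Increasing.
Variables (m n : nat) (f : 'I_m -> 'I_n).
Hypothesis f_mono : forall i j : 'I_m, (i < j)%N -> (f i < f j)%N.

Lemma increasing_inj : injective f.
Proof.
move=> i j fij; apply: val_inj; case: (ltngtP i j) => // /f_mono.
  by rewrite fij ltnn.
by rewrite fij ltnn.
Qed.

Lemma enum_imset_increasing (V : {set 'I_m}) : enum (f @: V) = map f (enum V).
Proof.
apply: (irr_sorted_eq (@ltn_ord_trans n)); first by move=> x; rewrite ltnn.
- exact: sorted_enum_ord.
- rewrite sorted_map; apply: (sub_sorted _ (sorted_enum_ord _)) => x y; exact: f_mono.
move=> x; rewrite mem_enum; apply/imsetP/mapP => -[y yV ->]; exists y => //.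
  by rewrite mem_enum.
by rewrite -mem_enum.
Qed.

Lemma block_cumulant_imset F (chi : 'I_n -> bool) a (V : {set 'I_m}) :
  block_cumulant F chi a (f @: V) = block_cumulant F (chi \o f) (a \o f) V.
Proof.
have e : #|f @: V| = #|V| by rewrite card_imset //; exact: increasing_inj.
have ev t : enum_val t = f (enum_val (cast_ord e t)).
  rewrite /enum_val enum_imset_increasing (nth_map (enum_default (cast_ord e t))) //.
  by rewrite -cardE -e.
by apply: (@cumulant_cast F _ _ e) => t; rewrite /restr ev.
Qed.

Lemma pos_increasing (chi : 'I_n -> bool) (i j : 'I_m) :
  (pos chi (f i) < pos chi (f j))%N = (pos (chi \o f) i < pos (chi \o f) j)%N.
Proof.
case: (ltngtP i j) => [ij|ji|/val_inj->]; last by rewrite !ltnn.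
  by rewrite !pos_lt //; apply: f_mono.
by rewrite !pos_gt //; apply: f_mono.
Qed.

(** Restriction to a subset only depends on the relative order of its elements, so
    an increasing renumbering respects bi-non-crossing partitions. *)
Lemma ncpart_imset (chi : 'I_n -> bool) (S : {set 'I_m}) :
  ncpart chi (f @: S) =
  [set [set f @: V | V : {set 'I_m} in pi] | pi : {set {set 'I_m}} in ncpart (chi \o f) S].
Proof.
have f_inj := increasing_inj.
have cf (pi : {set {set 'I_m}}) :
    crossfree chi [set f @: V | V : {set 'I_m} in pi] = crossfree (chi \o f) pi.
  apply/crossfreeP/crossfreeP => h.
    move=> V W a b c d Vp Wp aV bW cV dW; rewrite -!pos_increasing => ab bc cd.
    apply: (imset_inj f_inj).
    by apply: (h _ _ (f a) (f b) (f c) (f d)) => //; apply: imset_f.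
  move=> ? ? ? ? ? ? /imsetP[V Vp ->] /imsetP[W Wp ->].
  move=> /imsetP[a aV ->] /imsetP[b bW ->] /imsetP[c cV ->] /imsetP[d dW ->].
  by rewrite !pos_increasing => ab bc cd; rewrite (h V W a b c d).
apply/setP => sigma; apply/idP/imsetP => [|[pi]].
  rewrite inE => /andP[ps cs].
  have es : sigma = [set f @: V | V : {set 'I_m} in [set f @^-1: W | W : {set 'I_n} in sigma]].
    rewrite -imset_comp -[LHS]imset_id; apply: eq_in_imset => W Ws /=.
    apply/setP => x; apply/idP/imsetP => [xW|[y]]; last by rewrite inE => yW ->.
    have : x \in f @: S by rewrite -(cover_partition ps); apply/bigcupP; exists W.
    by case/imsetP => y yS ex; exists y; rewrite // inE -ex.
  exists [set f @^-1: W | W : {set 'I_n} in sigma] => //.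
  rewrite es imset_partition // in ps; rewrite es cf in cs.
  by rewrite in_set ps cs.
by rewrite inE => /andP[pp cp] ->; rewrite inE cf cp imset_partition ?pp.
Qed.
End Increasing.

(** The defining formula of the cumulants of a restricted word, with the partitions
    of its positions pushed forward to partitions of the subset itself. *)
Lemma moment_cumulant_subset (phi : A -> K) kappa n (chi : 'I_n -> bool) a (S : {set 'I_n}) :
  is_cumulants phi kappa -> S != set0 ->
  phi (\prod_(k < n | k \in S) a k) =
  \sum_(pi in ncpart chi S) \prod_(V in pi) block_cumulant kappa chi a V.
Proof.
move=> [_ hk] S0.
pose f := enum_val : 'I_#|S| -> 'I_n.
have f_mono (i j : 'I_#|S|) : (i < j)%N -> (f i < f j)%N.
  move=> ij; have x0 := f i.
  rewrite /f !(enum_val_nth x0).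
  by apply: (sorted_ltn_nth (@ltn_ord_trans n) x0 (sorted_enum_ord _)); rewrite // inE -cardE.
have fS : f @: [set: 'I_#|S|] = S.
  apply/setP => x; apply/imsetP/idP => [[t _ ->]|xS]; first exact: enum_valP.
  by exists (enum_rank_in xS x); rewrite // /f enum_rankK_in.
have f_inj := increasing_inj f_mono.
have <- : \prod_(t < #|S|) (a \o f) t = \prod_(k < n | k \in S) a k.
  rewrite prod_enum -[in RHS]fS enum_imset_increasing // big_map -prod_enum.
  by apply: eq_bigl => t; rewrite inE.
rewrite (hk _ (chi \o f)) ?card_gt0 // BNC_ncpart -[in RHS]fS ncpart_imset //.
rewrite big_imset /=; last by move=> x y _ _; apply/imset_inj/imset_inj.
apply: eq_bigr => pi _; rewrite big_imset /=; last by move=> x y _ _; apply: imset_inj.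
by apply: eq_bigr => V _; rewrite block_cumulant_imset.
Qed.
End Moments.

(** * Closing the block of one element *)

Section Fock.
Variables (K : fieldType) (n : nat) (chi : 'I_n -> bool) (wt : {set 'I_n} -> K).
Implicit Types (i : 'I_n) (S U V W : {set 'I_n}) (pi : {set {set 'I_n}}).

(** New letters are added on the left of the [s_chi] order when [i] is a left index
    and on its right otherwise: [x] is met before [y] when entering from the side of [i]. *)
Definition closer i (x y : 'I_n) : bool :=
  if chi i then (pos chi x < pos chi y)%N else (pos chi y < pos chi x)%N.

Definition initial i U S : bool :=
  (U \subset S) && [forall u in U, forall x in S :\: U, closer i u x].

Lemma initialP i U S :
  reflect (U \subset S /\ forall u x, u \in U -> x \in S -> x \notin U -> closer i u x)
          (initial i U S).
Proof.
apply: (iffP andP) => -[US h]; split=> //.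
  move=> u x uU xS xU; move/forall_inP: h => /(_ u uU)/forall_inP; apply.
  by rewrite inE xU.
apply/forall_inP => u uU; apply/forall_inP => x; rewrite inE => /andP[xU xS].
exact: h.
Qed.

Lemma pos_total (x y : 'I_n) : x != y -> (pos chi x < pos chi y)%N = false -> (pos chi y < pos chi x)%N.
Proof.
by move=> xy /negbT; rewrite -leqNgt leq_eqVlt (inj_eq (@pos_inj _ _)) eq_sym (negbTE xy).
Qed.

Definition meets W pi : bool := [forall B in pi, B :&: W != set0].

(** The total weight of the ways of completing a stack [V] of open elements by the operators
    with indices in [W], all smaller than those of [V]: every element of [V]
    must end in a block closed by some element of [W]. *)
Definition rooted_sum W V : K :=
  \sum_(pi in ncpart chi (W :|: V) | meets W pi) \prod_(B in pi) wt B.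

Section Step.
Variables (W V : {set 'I_n}) (i : 'I_n).
Hypothesis Wi : forall x, x \in W -> (x < i)%N.
Hypothesis iV : forall y, y \in V -> (i < y)%N.

Lemma pos_before x y : x \in W -> y \in i |: V -> (pos chi x < pos chi y)%N = chi x.
Proof.
move=> /Wi xi /setU1P[->|/iV iy]; first exact: pos_lt.
exact/pos_lt/(ltn_trans xi).
Qed.

Lemma before_neq x y : x \in W -> y \in i |: V -> y != x.
Proof.
move=> /Wi xi /setU1P[->|/iV iy]; rewrite -val_eqE neq_ltn ?xi ?orbT //.
by rewrite (ltn_trans xi iy) orbT.
Qed.

(** An element [x] of the stack lying between [i] and an element of its block [B]
    would have to join a block containing some [w] in [W]; as [w] lies outside the span
    of [i] and [V] in the order of [s_chi], that block would cross [B]. *)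
Lemma initial_block pi B : pi \in ncpart chi (W :|: (i |: V)) -> B \in pi -> i \in B ->
  B :&: W == set0 -> (forall B', B' \in pi -> B' != B -> B' :&: W != set0) ->
  initial i (B :\ i) V.
Proof.
rewrite inE => /andP[ppi /crossfreeP cf] Bpi iB /eqP BW hB.
have BV x : x \in B -> x \in i |: V.
  move=> xB; have := subsetP (partitionS ppi Bpi) x xB; rewrite inE => /orP[xW|//].
  by have : x \in B :&: W; [rewrite inE xB | rewrite BW inE].
apply/initialP; split=> [|u x].
  by apply/subsetP => x /setD1P[xi /BV]; rewrite inE (in_set1) (negbTE xi).
move=> /setD1P[ui uB] xV xBi; have ix := iV xV.
have xi : x != i by rewrite -val_eqE neq_ltn ix orbT.
have xB : x \notin B by apply: contra xBi => xB; rewrite in_setD1 xi.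
have xS : x \in cover pi by rewrite (cover_partition ppi) !inE xV !orbT.
have [B'pi xB'] : pblock pi x \in pi /\ x \in pblock pi x by rewrite pblock_mem ?mem_pblock.
move: (pblock pi x) B'pi xB' => B' B'pi xB'.
have nBB : B' <> B by move=> e; rewrite -e xB' in xB.
have /set0Pn[w /setIP[wB' wW]] : B' :&: W != set0 by apply: hB => //; apply/eqP.
have xu : x != u by apply: contraNneq xB => ->.
have wi := pos_before wW (BV i iB); have wu := pos_before wW (BV u uB).
have ni := before_neq wW (BV i iB); have nu := before_neq wW (BV u uB).
rewrite eq_sym in ni; rewrite eq_sym in nu.
have pix := pos_lt chi ix.
rewrite /closer; case ci: (chi i) pix => pix; apply: contra_notT nBB => h.
  have {}h : (pos chi x < pos chi u)%N by apply: pos_total; [rewrite eq_sym | exact: negbTE].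
  case cw: (chi w) in wi wu.
    exact: (cf B' B w i x u).
  by apply/esym/(cf B B' i x u w) => //; apply: pos_total.
have {}h : (pos chi u < pos chi x)%N by apply: pos_total => //; exact: negbTE.
have {}pix : (pos chi x < pos chi i)%N by apply: pos_total => //; rewrite eq_sym.
case cw: (chi w) in wi wu.
  exact: (cf B' B w u x i).
by apply/esym/(cf B B' u x i w) => //; apply: pos_total.
Qed.

(** Conversely, the set [(i,U)] is an interval of [(i,W,V)] in the order of
    [s_chi], so that no block can cross it. *)
Lemma initial_convex U a b c : initial i U V -> a \in i |: U -> c \in i |: U ->
  b \in W :|: (V :\: U) -> (pos chi a < pos chi b)%N -> (pos chi b < pos chi c)%N -> False.
Proof.
move=> /initialP[UV hU] aU cU; rewrite inE => /orP[bW|/setDP[bV bU]] ab bc.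
  have mV x : x \in i |: U -> x \in i |: V by apply/subsetP/setUS.
  move: bc; rewrite (pos_before bW (mV c cU)) -(pos_before bW (mV a aU)).
  by rewrite ltnNge (ltnW ab).
have ib := pos_lt chi (iV bV).
have bi : b != i by rewrite -val_eqE neq_ltn iV ?orbT.
move: hU; rewrite /closer; case: (chi i) ib => ib hU.
  suff cb : (pos chi c < pos chi b)%N by move: bc; rewrite ltnNge (ltnW cb).
  by case/setU1P: cU => [->//|cU]; apply: hU.
suff ba : (pos chi b < pos chi a)%N by move: ab; rewrite ltnNge (ltnW ba).
case/setU1P: aU => [->|aU]; last exact: hU.
by apply: pos_total => //; rewrite eq_sym.
Qed.

Lemma rooted_block pi B : meets (i |: W) pi -> B \in pi -> B :&: W == set0 -> i \in B.
Proof.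
move=> /forall_inP h Bpi /eqP BW; have /set0Pn[x /setIP[xB /setU1P[<-//|xW]]] := h B Bpi.
by have : x \in B :&: W; [rewrite inE xB | rewrite BW inE].
Qed.

Lemma crossfreeU1 U pi : initial i U V -> partition pi (W :|: (V :\: U)) ->
  crossfree chi pi -> crossfree chi ((i |: U) |: pi).
Proof.
move=> hU ppi /crossfreeP cf.
have mem B x : B \in pi -> x \in B -> x \in W :|: (V :\: U).
  by move=> Bpi; apply/subsetP/(partitionS ppi).
apply/crossfreeP => B1 B2 a b c d /setU1P[->|B1pi] /setU1P[->|B2pi] // aB bB cB dB ab bc cd.
- by case: (initial_convex hU aB cB (mem _ _ B2pi bB) ab bc).
- by case: (initial_convex hU bB dB (mem _ _ B1pi cB) bc cd).
exact: (cf B1 B2 a b c d).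
Qed.

(** Either the block of [i] contains a smaller index, and then [i] joins the stack, or
    [i] is its smallest element, and then the rest of the block is taken from the
    stack, where it has to be an initial segment. *)
Lemma rooted_sum_step :
  rooted_sum (i |: W) V =
  rooted_sum W (i |: V) + \sum_(U | initial i U V) wt (i |: U) * rooted_sum W (V :\: U).
Proof.
rewrite /rooted_sum; set S := W :|: (i |: V).
have -> : (i |: W) :|: V = S by rewrite /S setUCA setUA.
rewrite (bigID (meets W)) /=; congr (_ + _).
  apply: eq_bigl => pi; rewrite -andbA; congr (_ && _).
  case m: (meets W pi); rewrite ?andbF ?andbT //; apply/forall_inP => B Bpi.
  have := forall_inP m B Bpi; apply: contraNneq => /eqP; rewrite setIUr setU_eq0 => /andP[_].
  by move/eqP->.
have iW : i \notin W by apply/negP => /Wi; rewrite ltnn.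
have iNV : i \notin V by apply/negP => /iV; rewrite ltnn.
(* If some block of [pi] misses [W], it is the block of [i], and only that one. *)
have special pi : pi \in ncpart chi S -> meets (i |: W) pi -> ~~ meets W pi ->
    [/\ pblock pi i \in pi, i \in pblock pi i, pblock pi i :&: W == set0,
        forall B', B' \in pi -> B' != pblock pi i -> B' :&: W != set0 &
        initial i (pblock pi i :\ i) V].
  move=> piS m /forall_inPn[B Bpi]; rewrite negbK => BW.
  have iB := rooted_block m Bpi BW.
  have /andP[ppi _] : partition pi S && crossfree chi pi by rewrite inE in piS.
  have tp := partition_trivIset ppi.
  have eB : pblock pi i = B by apply: def_pblock.
  have hB B' : B' \in pi -> B' != B -> B' :&: W != set0.
    move=> B'pi; apply: contraNneq => /eqP B'W.
    by rewrite -eB (def_pblock tp B'pi) // (rooted_block m).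
  by rewrite eB; split=> //; apply: initial_block hB.
(* Sort the remaining partitions by the block [i |: U] of [i], and remove it. *)
rewrite (partition_big (fun pi => pblock pi i :\ i) (fun U => initial i U V)) /=; last first.
  by move=> pi /andP[/andP[piS m] nm]; have [] := special pi piS m nm.
apply: eq_bigr => U hU; have /initialP[UV _] := hU.
have iU : i \notin U by apply: contra iNV; apply/subsetP.
have Pi_notin pi : partition pi (W :|: (V :\: U)) -> i |: U \notin pi.
  move=> ppi; apply/negP => /(partitionS ppi)/subsetP/(_ i (setU11 _ _)).
  by rewrite !inE (negbTE iW) (negbTE iNV) andbF.
rewrite (reindex_onto (fun pi => (i |: U) |: pi) (fun pi => pi :\ (i |: U))) /=; last first.
  move=> pi /andP[/andP[/andP[piS m] nm] /eqP e].
  have [Bpi iB _ _ _] := special pi piS m nm.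
  by apply: setD1K; rewrite -e setD1K.
rewrite big_distrr /=; apply: eq_big => [pi|pi]; last first.
  move=> /andP[_ /eqP e]; rewrite big_setU1 //=.
  by rewrite -e in_setD1 eqxx.
apply/idP/idP.
  case/andP => /andP[/andP[/andP[piS m] nm] /eqP eU] /eqP e.
  have [Bpi iB BW hB _] := special _ piS m nm.
  have eB : pblock (i |: U |: pi) i = i |: U by rewrite -{2}eU setD1K.
  rewrite eB in Bpi iB BW hB.
  move: piS; rewrite inE => /andP[ppi cf].
  have := partitionD1 ppi Bpi; rewrite e => ppi'.
  have eS : S :\: (i |: U) = W :|: (V :\: U).
    apply/setP => x; rewrite !inE; case: eqVneq => [->|_] /=.
      by rewrite (negbTE iW) (negbTE iNV) andbF.
    case xU: (x \in U) => //=; rewrite orbF; apply: esym; apply/negbTE/negP => /Wi xi.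
    have := iV (subsetP UV x xU); rewrite ltnNge (ltnW xi) //.
  rewrite eS in ppi'; rewrite inE ppi' /=; apply/andP; split.
    apply/crossfreeP => B1 B2 a b c d B1pi B2pi; apply: (crossfreeP _ _ cf) => //.
      by rewrite inE B1pi orbT.
    by rewrite inE B2pi orbT.
  apply/forall_inP => B BP; apply: hB; first by rewrite inE BP orbT.
  by apply: contraTneq BP => ->; apply: Pi_notin.
case/andP; rewrite inE => /andP[ppi cf] m.
have iUpi := Pi_notin pi ppi.
have eS : S = (i |: U) :|: (W :|: (V :\: U)).
  apply/setP => x; rewrite !inE.
  by case: (x == i); case: (x \in W); case xU: (x \in U); rewrite ?(subsetP UV x xU) ?orbT.
have dis : [disjoint i |: U & W :|: (V :\: U)].
  rewrite -setI_eq0; apply/eqP/setP => x; rewrite !inE.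
  apply/negbTE/negP => /andP[/orP[/eqP->|xU]]; rewrite ?(negbTE iW) ?(negbTE iNV) ?andbF //.
  rewrite xU orbF => /Wi xi; have := iV (subsetP UV x xU); by rewrite ltnNge (ltnW xi).
have ppi1 : partition (i |: U |: pi) S.
  by rewrite eS; apply: partitionU1 => //; apply/set0Pn; exists i; rewrite setU11.
have eB : pblock (i |: U |: pi) i = i |: U.
  by apply: def_pblock; rewrite ?setU11 ?(partition_trivIset ppi1).
rewrite inE ppi1 crossfreeU1 //= eB setU1K // setU1K // !eqxx !andbT.
apply/andP; split.
  apply/forall_inP => B /setU1P[->|Bpi].
    by apply/set0Pn; exists i; rewrite inE !setU11.
  have := forall_inP m B Bpi; apply: contraNneq => /eqP; rewrite setIUr setU_eq0 => /andP[_].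
  by move/eqP->.
apply/forall_inPn; exists (i |: U); rewrite ?setU11 // negbK.
rewrite -subset0 -(eqP (_ : (i |: U) :&: (W :|: (V :\: U)) == set0)) ?setI_eq0 //.
by rewrite setIS // subsetUl.
Qed.
End Step.
End Fock.

(** * Fock families *)

Section FockFamily.
Variables (K : fieldType) (n : nat) (chi : 'I_n -> bool) (wt : {set 'I_n} -> K).
Variables (X : lmodType K) (T : 'I_n -> {linear X -> X}).
Implicit Types (S U V W : {set 'I_n}) (w : seq 'I_n).

(** The action of the canonical operators on the full Fock space, with the basis indexed by
    sets of times instead of words. *)
Definition fock_family (E : {set 'I_n} -> X) : Prop :=
  forall (i : 'I_n) S, (forall x, x \in S -> (i < x)%N) ->
    T i (E S) = E (i |: S) + \sum_(U | initial chi i U S) wt (i |: U) *: E (S :\: U).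

Definition apply_word w (x : X) : X := foldr (fun i => T i) x w.

Fact apply_word_linear w : linear (apply_word w).
Proof. by elim: w => [|i w IH] c x y //=; rewrite IH linearP. Qed.
HB.instance Definition _ w := GRing.isLinear.Build K _ _ _ (apply_word w) (apply_word_linear w).

Lemma rooted_sum0 V : rooted_sum chi wt set0 V = (V == set0)%:R.
Proof.
rewrite /rooted_sum set0U; have [->|V0] := eqVneq V set0.
  rewrite (big_pred1 set0) ?big_set0 // => pi.
  rewrite inE partition_set0 /=; case: eqVneq => [->|_] //=.
  have -> : crossfree chi set0 by apply/crossfreeP => B1 B2 a b c d; rewrite inE.
  by apply/forall_inP => B; rewrite inE.
rewrite big_pred0 // => pi; apply/negbTE/andP => -[].
rewrite inE => /andP[ppi _] /forall_inP m; have /set0Pn[x xV] := V0.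
have := m (pblock pi x); rewrite setI0 eqxx pblock_mem ?(cover_partition ppi) // => h.
by have := h isT.
Qed.

Lemma rooted_sum_all S : rooted_sum chi wt S set0 = \sum_(pi in ncpart chi S) \prod_(B in pi) wt B.
Proof.
rewrite /rooted_sum setU0; apply: eq_bigl => pi; apply/andb_idr; rewrite inE => /andP[ppi _].
apply/forall_inP => B Bpi; rewrite (setIidPl (partitionS ppi Bpi)).
exact: partition_neq0 ppi Bpi.
Qed.

(** The vectors [E V] with [V] strictly between the empty set and [S] are the
    intermediate stacks.  The term [theta (E S)] is kept because the lemma also
    serves to prove that it vanishes. *)
Lemma fock_vacuum (E : {set 'I_n} -> X) (theta : {scalar X}) S :
  fock_family E -> theta (E set0) = 1 -> S != set0 ->
  (forall V, V \proper S -> V != set0 -> theta (E V) = 0) ->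
  theta (apply_word (enum S) (E set0)) =
  theta (E S) + \sum_(pi in ncpart chi S) \prod_(B in pi) wt B.
Proof.
move=> hE E0 S0 hS.
(* [w] lists the operators still to be applied, [V] is the current stack. *)
have gen w V : (forall x y, x \in w -> y \in V -> (x < y)%N) ->
    sorted (fun x y : 'I_n => (x < y)%N) w -> [set x in w] :|: V \subset S ->
    theta (apply_word w (E V)) =
    ([set x in w] :|: V == S)%:R * theta (E S) + rooted_sum chi wt [set x in w] V.
  elim/last_ind: w V => [|w i IH] V wV sw wVS.
    rewrite set_nil set0U rooted_sum0 in wVS *.
    have [->|VS] := eqVneq V S; first by rewrite mul1r (negbTE S0) addr0.
    rewrite mul0r add0r; have [->//|V0] := eqVneq V set0.
    by rewrite hS // properEneq VS.
  have wi x : x \in w -> (x < i)%N.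
    move=> xw; move: sw; rewrite sorted_pairwise; last exact: ltn_ord_trans.
    by rewrite pairwise_rcons => /andP[/allP h _]; apply: h.
  have iV y : y \in V -> (i < y)%N by move=> yV; apply: wV => //; rewrite mem_rcons mem_head.
  have wV' x y : x \in w -> y \in V -> (x < y)%N by move=> /wi xi /iV; apply: ltn_trans.
  have eW : [set x in rcons w i] = i |: [set x in w].
    by apply/setP => x; rewrite !inE mem_rcons inE.
  have sw' : sorted (fun x y : 'I_n => (x < y)%N) w.
    by apply: (subseq_sorted (@ltn_ord_trans n)) sw; exact: subseq_rcons.
  have iNw : i \notin w by apply/negP => /wi; rewrite ltnn.
  have iNV : i \notin V by apply/negP => /iV; rewrite ltnn.
  rewrite eW in wVS *.
  have -> : apply_word (rcons w i) (E V) = apply_word w (T i (E V)) by rewrite /apply_word foldr_rcons.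
  rewrite hE // linearD linearD linear_sum linear_sum /=.
  rewrite IH //; first last.
  - by move: wVS; rewrite setUCA setUA.
  - by move=> x y xw /setU1P[->|yV]; [exact: wi | exact: wV'].
  rewrite rooted_sum_step //; last by move=> x; rewrite inE; exact: wi.
  rewrite -addrA setUCA setUA; congr (_ + (_ + _)); apply: eq_bigr => U hU.
  rewrite linearZ linearZ /= IH //.
  - have -> : ([set x in w] :|: V :\: U == S) = false.
      apply/negbTE/eqP => e; have : i \in S by apply: (subsetP wVS); rewrite !inE eqxx.
      by rewrite -e !inE (negbTE iNw) (negbTE iNV) andbF.
    by rewrite mul0r add0r.
  - by move=> x y xw /setDP[yV _]; apply: wV'.
  apply: subset_trans wVS; rewrite -setUA; apply: subset_trans (subsetUr _ _).
  by apply: setUS; apply: subsetDl.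
have eS : [set x in enum S] = S by apply/setP => x; rewrite inE mem_enum.
have := gen (enum S) set0; rewrite eS setU0 eqxx mul1r rooted_sum_all; apply=> //.
  by move=> x y _; rewrite inE.
exact: sorted_enum_ord.
Qed.

(** The relation of a Fock family, solved for [E (i |: S)] by recursion on the time
    [i]; the list [l] holds the times that remain to be examined. *)
Fixpoint fock_vec (xi : X) (l : seq 'I_n) (S : {set 'I_n}) : X :=
  if l is i :: l' then
    if i \in S then
      T i (fock_vec xi l' (S :\ i))
      - \sum_(U | initial chi i U (S :\ i)) wt (i |: U) *: fock_vec xi l' (S :\ i :\: U)
    else fock_vec xi l' S
  else xi.

Lemma fock_vec0 xi l : fock_vec xi l set0 = xi.
Proof. by elim: l => //= i l ->; rewrite inE. Qed.

Lemma fock_vec_skip xi l1 l2 S : (forall x, x \in l1 -> x \notin S) ->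
  fock_vec xi (l1 ++ l2) S = fock_vec xi l2 S.
Proof.
elim: l1 => //= i l1 IH h; rewrite (negbTE (h i (mem_head _ _))) IH // => x xl.
by apply: h; rewrite inE xl orbT.
Qed.

Lemma fock_vec_family xi : fock_family (fock_vec xi (enum 'I_n)).
Proof.
move=> i S iS; have := sorted_enum_ord (mem 'I_n).
have : i \in enum 'I_n by rewrite mem_enum.
case/splitPr => l1 l2; rewrite sorted_pairwise; last exact: ltn_ord_trans.
rewrite pairwise_cat pairwise_cons => /and3P[/allrelP h12 _ /andP[/allP hi _]].
have l1i x : x \in l1 -> (x < i)%N by move=> xl; apply: h12; rewrite ?mem_head.
have iNS : i \notin S by apply/negP => /iS; rewrite ltnn.
have skip V : V \subset S -> fock_vec xi (l1 ++ i :: l2) V = fock_vec xi l2 V.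
  move=> VS; rewrite -cat_rcons fock_vec_skip // => x; rewrite mem_rcons inE => xl.
  apply/negP => xV; have := iS x (subsetP VS x xV).
  by case/orP: xl => [/eqP->|/l1i lxi]; rewrite ?ltnn // ltnNge (ltnW lxi).
rewrite [fock_vec _ _ (i |: S)]fock_vec_skip; last first.
  move=> x xl; rewrite !inE negb_or -val_eqE neq_ltn l1i //=.
  by apply/negP => /iS; rewrite ltnNge ltnW // l1i.
rewrite /= setU11 setU1K // skip // -addrA [X in _ + X](_ : _ = 0) ?addr0 //.
apply/eqP; rewrite addrC subr_eq0; apply/eqP/eq_bigr => U _.
by rewrite skip // subsetDl.
Qed.
End FockFamily.

(** * Runs of one colour *)

Section PositionOrder.
Variables (n : nat) (chi : 'I_n -> bool).
Implicit Types (A B S : {set 'I_n}).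

Definition pos_lt_rel : rel 'I_n := fun x y => (pos chi x < pos chi y)%N.

Lemma pos_lt_rel_trans : transitive pos_lt_rel.
Proof. by move=> y x z; apply: ltn_trans. Qed.

Lemma pos_lt_rel_irr : irreflexive pos_lt_rel.
Proof. by move=> x; apply: ltnn. Qed.

Definition by_pos S : seq 'I_n := [seq x <- s_seq chi | x \in S].

Lemma mem_by_pos S x : (x \in by_pos S) = (x \in S).
Proof. by rewrite mem_filter mem_s_seq andbT. Qed.

Lemma sorted_by_pos S : sorted pos_lt_rel (by_pos S).
Proof.
rewrite sorted_filter //; first exact: pos_lt_rel_trans.
case: (posnP n) => [n0|n_gt0].
  by case: (s_seq chi) => [|x s] //; have := ltn_ord x; rewrite {2}n0.
apply/(sortedP (Ordinal n_gt0)) => j hj.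
by rewrite /pos_lt_rel /pos !index_uniq ?uniq_s_seq //; apply: ltnW.
Qed.

Lemma by_pos_cat A B : (forall a b, a \in A -> b \in B -> (pos chi a < pos chi b)%N) ->
  by_pos (A :|: B) = by_pos A ++ by_pos B.
Proof.
move=> AB; apply: (irr_sorted_eq pos_lt_rel_trans pos_lt_rel_irr); first exact: sorted_by_pos.
  rewrite sorted_pairwise; last exact: pos_lt_rel_trans.
  rewrite pairwise_cat -!sorted_pairwise ?sorted_by_pos ?andbT; try exact: pos_lt_rel_trans.
  by apply/allrelP => a b; rewrite !mem_by_pos; apply: AB.
by move=> x; rewrite mem_cat !mem_by_pos inE.
Qed.

Lemma by_pos_nil S : (by_pos S == [::]) = (S == set0).
Proof.
apply/eqP/eqP => [e|->]; last by rewrite /by_pos (eq_filter (a2 := pred0)) ?filter_pred0 // => x; rewrite inE.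
by apply/setP => x; rewrite -mem_by_pos e inE.
Qed.
End PositionOrder.

Section Runs.
Variables (n : nat) (eps : 'I_n -> bool).
Implicit Types (s : seq 'I_n) (rs : seq (bool * {set 'I_n})).

Definition push_run (i : 'I_n) rs : seq (bool * {set 'I_n}) :=
  if rs is (d, R) :: rs' then
    if d == eps i then (d, i |: R) :: rs' else (eps i, [set i]) :: rs
  else [:: (eps i, [set i])].

(** The maximal runs of one colour.  Of each run only the colour and the set of its
    elements matter, since the vectors of a Fock family are indexed by sets. *)
Definition runs s := foldr push_run [::] s.

Lemma runs_push i s : runs (i :: s) = push_run i (runs s).
Proof. by []. Qed.

Lemma runs_cons i s : exists R rs, runs (i :: s) = (eps i, R) :: rs.
Proof.
rewrite /=; case: (runs s) => [|[d R] rs] /=; first by exists [set i], [::].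
by case: eqP => [<-|_]; [exists (i |: R), rs | exists [set i], ((d, R) :: rs)].
Qed.

Lemma runs_neq0 s : all (fun r => r.2 != set0) (runs s).
Proof.
elim: s => //= i s; case: (runs s) => [|[d R] rs] /=.
  by rewrite andbT => _; apply/set0Pn; exists i; rewrite inE.
case/andP=> R0 h; case: eqP => _ /=; rewrite h ?R0 ?andbT.
  by apply/set0Pn; exists i; rewrite setU11.
by apply/set0Pn; exists i; rewrite inE.
Qed.

Lemma runs_sorted s : sorted (fun d d' : bool => d != d') (map fst (runs s)).
Proof.
elim: s => //= i s; case: (runs s) => [|[d R] rs] //= h.
by case: eqVneq => //= de; rewrite eq_sym de.
Qed.

Lemma runs_head d s : head d (map fst (runs s)) = head d (map eps s).
Proof. by case: s => // i s; have [R [rs ->]] := runs_cons i s. Qed.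

Lemma runs_last d s : last d (map fst (runs s)) = last d (map eps s).
Proof.
elim: s d => //= i s IH d; rewrite -IH; case: (runs s) => [|[e R] rs] //=.
by case: eqP.
Qed.

Lemma runs_cat s1 s2 :
  (if s2 is y :: _ then last (~~ eps y) (map eps s1) != eps y else true) ->
  runs (s1 ++ s2) = runs s1 ++ runs s2.
Proof.
case: s2 => [|y s2]; first by rewrite !cats0.
elim: s1 => // x s1 IH; case: s1 IH => [_ /= xy|z s1 IH h].
  have [R [rs]] := runs_cons y s2; rewrite /= => ->.
  by rewrite /= eq_sym (negbTE xy).
rewrite cat_cons runs_push IH // [in RHS]runs_push.
by have [R [rs ->]] := runs_cons z s1; rewrite /=; case: eqP.
Qed.

Lemma runs_mono d s : s != [::] -> all (fun x => eps x == d) s -> runs s = [:: (d, [set x in s])].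
Proof.
elim: s => // x [|y s] IH _ /andP[/eqP xd h].
  by rewrite /= xd; congr [:: (_, _)]; apply/setP => z; rewrite !inE.
rewrite runs_push IH // /push_run xd eqxx; congr [:: (_, _)].
by apply/setP => z; rewrite !inE.
Qed.
End Runs.

(** * The Fock family of a free product *)

Section FreeProductFock.
Variables (K : fieldType) (X : bool -> pvspace K) (n : nat) (chi : 'I_n -> bool).
Variables (wt : bool -> {set 'I_n} -> K) (T : forall d, 'I_n -> {linear X d -> X d}).
Variable E : forall d, {set 'I_n} -> X d.
Hypothesis E_fock : forall d, fock_family chi (wt d) (@T d) (@E d).
Hypothesis E_empty : forall d, E d set0 = pv_xi (X d).
Hypothesis E_coef : forall d (S : {set 'I_n}), S != set0 -> pv_coef (E d S) = 0.
Variable eps : 'I_n -> bool.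
Implicit Types (R S U V Q : {set 'I_n}) (rs : seq (bool * {set 'I_n})).
Local Notation FP := (free_product X).

Definition run_letters rs : seq (letter X) := [seq ltr (E r.1 r.2) | r <- rs].

Definition mixed_vec S : FP := wtens predT (run_letters (runs eps (by_pos chi S))).

(** For a non-empty set this sum has at most one term: it is the weight of the colour
    of [V], or [0] if [V] has several colours. *)
Definition mixed_weight V : K := \sum_(d | V \subset [set x | eps x == d]) wt d V.

Definition mixed_op (i : 'I_n) : {linear FP -> FP} :=
  if chi i then (lambda_act (T (eps i) i) : {linear FP -> FP}) else rho_act (T (eps i) i).

Lemma tags_run_letters rs : map tag (run_letters rs) = map fst rs.
Proof. by rewrite -map_comp; apply: eq_map. Qed.

Lemma E_ker d S : S != set0 -> pv_proj (X d) (E d S) = 0.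
Proof. by move=> S0; rewrite pv_projE E_coef // scale0r. Qed.

Lemma is_word_runs (P : pred (seq bool)) s : P (map fst (runs eps s)) ->
  is_word (X := X) P (run_letters (runs eps s)).
Proof.
rewrite /is_word tags_run_letters runs_sorted => ->; rewrite andbT /= all_map.
by apply: sub_all (runs_neq0 eps s) => r r0; rewrite /= /in_ker E_ker.
Qed.

Lemma wtens_zero u v d : is_word predT (u ++ ltr (0 : X d) :: v) ->
  wtens predT (u ++ ltr (0 : X d) :: v) = 0.
Proof.
move=> w; have := @wtens_multilin K X predT u v d (-1) 0 0.
by rewrite scaler0 addr0 => /(_ w w w); rewrite scaleN1r addNr.
Qed.

Lemma mixed_vec0 : mixed_vec set0 = pv_xi FP.
Proof. by rewrite /mixed_vec (eqP (_ : by_pos chi set0 == [::])) // by_pos_nil. Qed.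

Lemma mixed_vec_coef S : S != set0 -> pv_coef (mixed_vec S) = 0.
Proof.
move=> S0; apply: pv_coef0; rewrite [LHS]fp_proj_wtens; last exact: is_word_runs.
move: S0; rewrite -(by_pos_nil chi); case: (by_pos chi S) => // x s _.
by have [R [rs ->]] := runs_cons eps x s.
Qed.

(** The vector of the empty run is [xi], which [V_d] absorbs; other runs become the
    first letter. *)
Lemma lglue_E d R s : is_word (lpred d) s ->
  lglue (E d R) s = wtens predT (if R == set0 then s else ltr (E d R) :: s).
Proof.
move=> ws; rewrite /lglue; case: eqVneq => [->|R0]; last first.
  by rewrite E_coef // scale0r add0r ker_part_id // E_ker.
have := lword_cons (pv_xi (X d)) ws; rewrite E_empty pv_coef_xi scale1r ker_part_xi => w.
by rewrite (@wtens_zero [::]) // addr0.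
Qed.

Lemma rglue_E d R s : is_word (rpred d) s ->
  rglue (E d R) s = wtens predT (if R == set0 then s else rcons s (ltr (E d R))).
Proof.
move=> ws; rewrite /rglue; case: eqVneq => [->|R0]; last first.
  by rewrite E_coef // scale0r add0r ker_part_id // E_ker.
have := rword_rcons (pv_xi (X d)) ws; rewrite E_empty pv_coef_xi scale1r ker_part_xi => w.
by rewrite -cats1 wtens_zero ?cats1 // addr0.
Qed.

Lemma runs_by_pos_mono d R : R != set0 -> R \subset [set x | eps x == d] ->
  runs eps (by_pos chi R) = [:: (d, R)].
Proof.
move=> R0 /subsetP Rd; rewrite (@runs_mono _ _ d) ?by_pos_nil //.
  by congr [:: (_, _)]; apply/setP => x; rewrite inE mem_by_pos.
by apply/allP => x; rewrite mem_by_pos => /Rd; rewrite inE.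
Qed.

(** Under [V_d] the first run of colour [d], possibly empty, is the vector of [X d] on which
    left operators of colour [d] act; the condition on the head says that the run ends there. *)
Lemma mixed_vec_left d R Q : R \subset [set x | eps x == d] ->
  (forall r q, r \in R -> q \in Q -> (pos chi r < pos chi q)%N) ->
  head (~~ d) (map eps (by_pos chi Q)) != d ->
  mixed_vec (R :|: Q) =
  Vmap (tens (E d R) (wtens (lpred d) (run_letters (runs eps (by_pos chi Q))))).
Proof.
move=> Rd RQ hQ.
have wQ : is_word (X := X) (lpred d) (run_letters (runs eps (by_pos chi Q))).
  by apply: is_word_runs; rewrite /lpred runs_head.
rewrite Vmap_tens // lglue_E // /mixed_vec; congr (wtens _ _).
case: eqVneq => [->|R0]; first by rewrite set0U.
rewrite by_pos_cat // runs_cat ?(runs_by_pos_mono R0 Rd) //.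
case: (by_pos chi Q) hQ => //= y s yd; apply: contra_neq yd => <-.
have : all (fun x => eps x == d) (by_pos chi R).
  by apply/allP => x; rewrite mem_by_pos => /(subsetP Rd); rewrite inE.
move: R0; rewrite -(by_pos_nil chi); case/lastP: (by_pos chi R) => // t z _.
by rewrite all_rcons map_rcons last_rcons => /andP[/eqP].
Qed.

(** The mirror image of [mixed_vec_left], for [W_d] and the last run. *)
Lemma mixed_vec_right d R Q : R \subset [set x | eps x == d] ->
  (forall r q, r \in R -> q \in Q -> (pos chi q < pos chi r)%N) ->
  last (~~ d) (map eps (by_pos chi Q)) != d ->
  mixed_vec (R :|: Q) =
  Wmap (tens (wtens (rpred d) (run_letters (runs eps (by_pos chi Q)))) (E d R)).
Proof.
move=> Rd RQ hQ.
have wQ : is_word (X := X) (rpred d) (run_letters (runs eps (by_pos chi Q))).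
  by apply: is_word_runs; rewrite /rpred runs_last.
rewrite Wmap_tens // rglue_E // /mixed_vec; congr (wtens _ _).
case: eqVneq => [->|R0]; first by rewrite set0U.
rewrite setUC by_pos_cat; last by move=> q r qQ rR; apply: RQ.
rewrite runs_cat ?(runs_by_pos_mono R0 Rd); last first.
  have : all (fun x => eps x == d) (by_pos chi R).
    by apply/allP => x; rewrite mem_by_pos => /(subsetP Rd); rewrite inE.
  by case: (by_pos chi R) => //= y s /andP[/eqP-> _].
by rewrite /run_letters map_cat cats1.
Qed.

Section Step.
Variables (i : 'I_n) (S : {set 'I_n}).
Hypothesis iS : forall x, x \in S -> (i < x)%N.

(** The run of [S] on the side of [i], if it has the colour of [i], and the empty set
    otherwise. *)
Definition near_run : {set 'I_n} :=
  [set r in S | [forall x in S, ~~ closer chi i r x ==> (eps x == eps i)]].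
Local Notation R := near_run.
Local Notation Q := (S :\: near_run).

Lemma closer_trans x y z : closer chi i x y -> closer chi i y z -> closer chi i x z.
Proof.
rewrite /closer; case: (chi i); first exact: ltn_trans.
by move=> xy yz; apply: ltn_trans xy.
Qed.

Lemma closer_irr x : closer chi i x x = false.
Proof. by rewrite /closer !ltnn if_same. Qed.

Lemma closer_total x y : x != y -> ~~ closer chi i x y -> closer chi i y x.
Proof.
move=> xy; rewrite /closer; case: (chi i) => /negbTE; first exact: pos_total.
by apply: pos_total; rewrite eq_sym.
Qed.

Lemma closer_i x : x \in S -> closer chi i i x.
Proof.
move=> /iS ix; have ni : i != x by rewrite -val_eqE neq_ltn ix.
rewrite /closer; have := pos_lt chi ix; case: (chi i) => // h.
exact: pos_total.
Qed.

Lemma near_runP r : reflect (r \in S /\ forall x, x \in S -> ~~ closer chi i r x -> eps x = eps i)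
                            (r \in R).
Proof.
rewrite inE; apply: (iffP andP) => -[rS h]; split=> //.
  by move=> x xS rx; move/forall_inP: h => /(_ x xS)/implyP/(_ rx)/eqP.
by apply/forall_inP => x xS; apply/implyP => rx; apply/eqP/h.
Qed.

Lemma near_run_sub : R \subset S.
Proof. by apply/subsetP => r /near_runP[]. Qed.

Lemma near_run_mono : R \subset [set x | eps x == eps i].
Proof.
by apply/subsetP => r /near_runP[rS h]; rewrite inE h // closer_irr.
Qed.

Lemma near_run_closer r q : r \in i |: R -> q \in Q -> closer chi i r q.
Proof.
move=> /setU1P[->|/near_runP[rS h]] /setDP[qS qR]; first exact: closer_i.
have rq : r != q.
  by apply: contraNneq qR => <-; apply/near_runP.
apply: contraNT qR => nrq; have qr := closer_total rq nrq.
apply/near_runP; split=> // x xS nqx; apply: h => //; apply: contra nqx.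
exact: closer_trans.
Qed.

(** Segments of [S] that can be closed with [i] by a non-zero weight lie in the first run,
    so that they are the segments seen by the operator on [X (eps i)]. *)
Lemma initial_near_run U : initial chi i U R =
  initial chi i U S && ((i |: U) \subset [set x | eps x == eps i]).
Proof.
apply/idP/andP => [/initialP[UR h]|[/initialP[US h] Um]].
  split; last by rewrite subUset sub1set inE eqxx (subset_trans UR near_run_mono).
  apply/initialP; split=> [|u x uU xS xU]; first exact: subset_trans UR near_run_sub.
  have [xR|xR] := boolP (x \in R); first exact: h.
  by apply: near_run_closer; rewrite ?in_setU1 ?in_setD ?(subsetP UR u uU) ?orbT ?xR.
have UR : U \subset R.
  apply/subsetP => u uU; apply/near_runP; split; first exact: (subsetP US).
  move=> x xS ux; apply/eqP; have [xU|xU] := boolP (x \in U).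
    by have := subsetP Um x; rewrite !inE xU orbT => /(_ isT).
  by rewrite (h u x uU xS xU) in ux.
apply/initialP; split=> // u x uU xR; apply: h => //.
exact: (subsetP near_run_sub).
Qed.

Lemma far_first q : q \in Q -> (forall x, x \in Q -> ~~ closer chi i x q) -> eps q != eps i.
Proof.
move=> /setDP[qS qR] first_q; apply: contra qR => /eqP qd.
apply/near_runP; split=> // x xS nqx.
have [xR|xR] := boolP (x \in R).
  by have := subsetP near_run_mono x xR; rewrite inE => /eqP.
have [<-//|xq] := eqVneq q x.
have := first_q x; rewrite in_setD xR xS => /(_ isT).
by rewrite (closer_total xq nqx).
Qed.

(** Grafts a vector on the runs of [S] beyond the one next to [i]. *)
Definition near_glue (x : X (eps i)) : FP :=
  let far := run_letters (runs eps (by_pos chi Q)) in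
  if chi i then Vmap (tens x (wtens (lpred (eps i)) far))
  else Wmap (tens (wtens (rpred (eps i)) far) x).

Fact near_glue_linear : linear near_glue.
Proof.
move=> c x y; rewrite /near_glue; case: (chi i).
  by rewrite tens_linl linearP.
by rewrite tens_linr linearP.
Qed.
HB.instance Definition _ := GRing.isLinear.Build K _ _ _ near_glue near_glue_linear.

Lemma mixed_op_near_glue x : mixed_op i (near_glue x) = near_glue (T (eps i) i x).
Proof.
rewrite /mixed_op /near_glue; case: (chi i).
  by rewrite [LHS]lambda_act_Vmap tmapE.
by rewrite [LHS]rho_act_Wmap tmapE.
Qed.

Lemma mixed_vec_near V : V \subset i |: R -> mixed_vec (V :|: Q) = near_glue (E (eps i) V).
Proof.
move=> VR; rewrite /near_glue.
have Vm : V \subset [set x | eps x == eps i].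
  by apply: subset_trans VR _; rewrite subUset sub1set inE eqxx near_run_mono.
have VQ r q : r \in V -> q \in Q -> closer chi i r q.
  by move=> rV; apply: near_run_closer; apply: (subsetP VR).
have eQ := mem_by_pos chi Q; have sQ := sorted_by_pos chi Q.
rewrite sorted_pairwise in sQ; last exact: pos_lt_rel_trans.
move: VQ; rewrite /closer; case ci: (chi i) => VQ.
  apply: mixed_vec_left => //.
  case: (by_pos chi Q) eQ sQ => [|q s] eQ sQ /=; first by case: (eps i).
  apply: far_first; first by rewrite -eQ mem_head.
  move=> x; rewrite -eQ inE => /orP[/eqP->|xs]; first by rewrite closer_irr.
  move: sQ => /= /andP[/allP/(_ x xs) qx _].
  by rewrite /closer ci -leqNgt ltnW.
apply: mixed_vec_right => //.
case/lastP: (by_pos chi Q) eQ sQ => [|s q] eQ sQ /=; first by case: (eps i).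
rewrite map_rcons last_rcons; apply: far_first; first by rewrite -eQ mem_rcons mem_head.
move=> x; rewrite -eQ mem_rcons inE => /orP[/eqP->|xs]; first by rewrite closer_irr.
move: sQ; rewrite pairwise_rcons => /andP[/allP/(_ x xs) qx _].
by rewrite /closer ci -leqNgt ltnW.
Qed.

(** All terms of the Fock relation in [X (eps i)] are vectors of subsets of [(i,near_run)],
    which grafting turns into vectors of the free product. *)
Lemma mixed_step :
  mixed_op i (mixed_vec S) =
  mixed_vec (i |: S) + \sum_(U | initial chi i U S) mixed_weight (i |: U) *: mixed_vec (S :\: U).
Proof.
have eS : S = R :|: Q by rewrite setDE setUIr setUCr setIT; apply/esym/setUidPr/near_run_sub.
rewrite {1}eS mixed_vec_near ?subsetUr // mixed_op_near_glue E_fock; last first.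
  by move=> x /(subsetP near_run_sub); apply: iS.
rewrite linearD linear_sum /= -mixed_vec_near // -setUA -eS; congr (_ + _).
rewrite [LHS]big_mkcond [RHS]big_mkcond; apply: eq_bigr => U _.
rewrite initial_near_run; case hU: (initial chi i U S) => //=.
rewrite /mixed_weight.
case: ifP => Um; last first.
  rewrite big_pred0 ?scale0r // => d; apply/negbTE/negP => h; move/negP: Um; apply.
  by have := subsetP h i (setU11 _ _); rewrite inE => /eqP->.
rewrite (big_pred1 (eps i)); last first.
  move=> d /=; apply/idP/eqP => [h|->//].
  by have := subsetP h i (setU11 _ _); rewrite inE => /eqP.
have UR : initial chi i U R by rewrite initial_near_run hU.
rewrite linearZ /= -mixed_vec_near; last by apply: subset_trans (subsetDl _ _) (subsetUr _ _).
congr (_ *: mixed_vec _); case/initialP: UR => UR _.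
apply/setP => x; rewrite !(in_setU, in_setD); case xR: (x \in R); rewrite ?andbT ?andbF ?orbF /=.
  by rewrite (subsetP near_run_sub x xR) ?andbT ?orbF.
by case xU: (x \in U) => //; rewrite (subsetP UR x xU) in xR.
Qed.
End Step.

Lemma mixed_fock : fock_family chi mixed_weight mixed_op mixed_vec.
Proof. by move=> i S iS; apply: mixed_step. Qed.
End FreeProductFock.

(** * Mixed moments of a bi-free pair *)

Section Embedding.
Variables (K : fieldType) (X : bool -> pvspace K) (d : bool).
Local Notation FP := (free_product X).

(** The canonical inclusion of [X d] into the free product. *)
Definition embed (x : X d) : FP :=
  pv_coef x *: pv_xi FP + wtens predT [:: ltr (ker_part x)].

Fact is_word_nil (P : pred (seq bool)) : P [::] -> is_word (X := X) P [::].
Proof. by rewrite /is_word /=. Qed.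

Lemma Vmap_embed x : Vmap (tens x (wtens (lpred d) [::])) = embed x.
Proof. by rewrite Vmap_tens // is_word_nil // /lpred /=; case: d. Qed.

Lemma Wmap_embed x : Wmap (tens (wtens (rpred d) [::]) x) = embed x.
Proof. by rewrite Wmap_tens // is_word_nil // /rpred /=; case: d. Qed.

Lemma lambda_act_embed (T : {linear X d -> X d}) x : lambda_act T (embed x) = embed (T x).
Proof. by rewrite -!Vmap_embed lambda_act_Vmap tmapE. Qed.

Lemma rho_act_embed (T : {linear X d -> X d}) x : rho_act T (embed x) = embed (T x).
Proof. by rewrite -!Wmap_embed rho_act_Wmap tmapE. Qed.

Lemma is_word_ker_part (x : X d) : is_word (X := X) predT [:: ltr (ker_part x)].
Proof. by rewrite /is_word /in_ker /= pv_proj_ker_part eqxx. Qed.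

Lemma embed_xi : embed (pv_xi (X d)) = pv_xi FP.
Proof.
have w := is_word_ker_part (pv_xi (X d)).
rewrite /embed pv_coef_xi scale1r ker_part_xi in w *.
by rewrite (@wtens_zero _ _ [::]) ?addr0.
Qed.

Lemma pv_coef_embed x : pv_coef (embed x) = pv_coef x.
Proof.
rewrite /embed linearP /= pv_coef_xi mulr1 [X in _ + X]pv_coef0 ?addr0 //.
by rewrite [LHS]fp_proj_wtens // is_word_ker_part.
Qed.
End Embedding.

Section BifreeMoments.
Variables (K : fieldType) (I J : Type) (A : algType K) (phi : A -> K).
Variables (kappa : cumulant_family A) (z : bool -> I + J -> A).
Hypothesis kappaP : is_cumulants phi kappa.

Section Model.
Variables (X : bool -> pvspace K).
Variables (l : forall d, ncpoly K I -> {linear X d -> X d}).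
Variables (r : forall d, ncpoly K J -> {linear X d -> X d}).
Hypothesis model_moments : forall w : seq (bool * (I + J)),
  vstate (foldr (fun q T => model_op l r q.1 q.2 \o T) idfun w)
  = phi (\prod_(q <- w) z q.1 q.2).
Variables (n : nat) (alpha : 'I_n -> I + J).
Local Notation chi := (chi_of alpha).
Local Notation FP := (free_product X).

Definition letter_op d (i : 'I_n) : {linear X d -> X d} :=
  match alpha i with inl a => l d (ncvar K a) | inr b => r d (ncvar K b) end.

Definition family_weight d : {set 'I_n} -> K :=
  block_cumulant kappa chi (fun k => z d (alpha k)).

Definition family_vec d : {set 'I_n} -> X d :=
  fock_vec chi (family_weight d) (@letter_op d) (pv_xi (X d)) (enum 'I_n).

Lemma model_wordE (w : seq (bool * (I + J))) x :
  foldr (fun q T => model_op l r q.1 q.2 \o T) idfun w x =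
  foldr (fun q => model_op l r q.1 q.2) x w.
Proof. by elim: w => //= q w ->. Qed.

Lemma model_moment_set (eps : 'I_n -> bool) (S : {set 'I_n}) :
  pv_coef (foldr (fun k => model_op l r (eps k) (alpha k)) (pv_xi FP) (enum S)) =
  phi (\prod_(k < n | k \in S) z (eps k) (alpha k)).
Proof.
have := model_moments [seq (eps k, alpha k) | k <- enum S].
by rewrite /vstate model_wordE foldr_map big_map prod_enum.
Qed.

(** On vectors coming from [X d], left and right operators of colour [d] both act
    as on [X d]: moments of one family are computed there. *)
Lemma model_op_embed d (i : 'I_n) (x : X d) :
  model_op l r d (alpha i) (embed x) = embed (letter_op d i x).
Proof.
by rewrite /letter_op; case: (alpha i) => a; [exact: lambda_act_embed | exact: rho_act_embed].
Qed.

Lemma family_moment d (S : {set 'I_n}) :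
  pv_coef (apply_word (@letter_op d) (enum S) (pv_xi (X d))) =
  phi (\prod_(k < n | k \in S) z d (alpha k)).
Proof.
rewrite -(model_moment_set (fun _ => d)) -(embed_xi X d) -[LHS]pv_coef_embed.
by congr pv_coef; elim: (enum S) => //= i w <-; rewrite model_op_embed.
Qed.

Lemma family_vec_empty d : family_vec d set0 = pv_xi (X d).
Proof. exact: fock_vec0. Qed.

(** Induction on [S]: by [fock_vacuum], the moment of [S] is the coefficient of [E S]
    plus the sum over non-crossing partitions, which equals the moment by itself. *)
Lemma family_vec_coef d (S : {set 'I_n}) : S != set0 -> pv_coef (family_vec d S) = 0.
Proof.
move: {2}#|S|.+1 (ltnSn #|S|) => m; elim: m S => // m IH S Sm S0.
have := @fock_vacuum K n chi (family_weight d) (X d) (@letter_op d) (family_vec d) (@pv_coef K (X d)) S.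
rewrite family_vec_empty /= family_moment (moment_cumulant_subset chi _ kappaP S0).
move=> /(_ (fock_vec_family _ _ _ _) (pv_coef_xi _) S0) h.
apply: (addIr (\sum_(pi in ncpart chi S) \prod_(V in pi) family_weight d V)).
rewrite add0r -h // => V VS V0; apply: IH => //.
by apply: leq_trans (proper_card VS) _; rewrite -ltnS.
Qed.

Lemma model_mixed_moment (eps : 'I_n -> bool) : (0 < n)%N ->
  phi (\prod_(k < n) z (eps k) (alpha k)) =
  \sum_(pi in BNC chi) \prod_(V in pi) mixed_weight family_weight eps V.
Proof.
move=> n_gt0.
have T0 : [set: 'I_n] != set0 by rewrite -card_gt0 cardsT card_ord.
have := @fock_vacuum K n chi (mixed_weight family_weight eps) FP
  (mixed_op chi letter_op eps) (mixed_vec chi family_vec eps) (@pv_coef K FP) [set: 'I_n].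
have fm := mixed_fock (fun d => fock_vec_family chi (family_weight d) (@letter_op d) (pv_xi (X d)))
  family_vec_empty family_vec_coef eps.
rewrite mixed_vec0 /= => /(_ fm (pv_coef_xi _) T0).
have cf (S : {set 'I_n}) (S0 : S != set0) := mixed_vec_coef chi family_vec_coef eps S0.
rewrite cf // add0r BNC_ncpart => <-; last by move=> V _; apply: cf.
have -> : \prod_(k < n) z (eps k) (alpha k) = \prod_(k < n | k \in [set: 'I_n]) z (eps k) (alpha k).
  by apply: eq_bigl => k; rewrite inE.
rewrite -model_moment_set; congr pv_coef.
elim: (enum _) => //= i w ->; rewrite /mixed_op /letter_op /chi_of.
by case: (alpha i).
Qed.
End Model.
End BifreeMoments.

(** * Moebius inversion *)

Section Inversion.
Variables (n : nat) (chi : 'I_n -> bool).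
Implicit Types (pi rho : {set {set 'I_n}}).

Lemma BNC_partition pi : pi \in BNC chi -> partition pi [set: 'I_n].
Proof. by rewrite BNC_ncpart inE => /andP[]. Qed.

Lemma one_part_BNC : (0 < n)%N -> one_part n \in BNC chi.
Proof.
move=> n0; rewrite BNC_ncpart inE; apply/andP; split.
  rewrite /one_part /partition /cover big_set1 eqxx trivIset1 inE /=.
  by rewrite eq_sym -card_gt0 cardsT card_ord.
by apply/crossfreeP => V W a b c d; rewrite !inE => /eqP-> /eqP->.
Qed.

Lemma refines_one_part pi : refines pi (one_part n).
Proof. by apply/forall_inP => V _; apply/exists_inP; exists setT; rewrite ?inE. Qed.

(** The Moebius function is defined as a left inverse of the zeta function; for square
    matrices a left inverse is a right inverse. *)
Lemma muBNC_sum_left pi sigma : pi \in BNC chi -> sigma \in BNC chi -> refines pi sigma ->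
  \sum_(rho in BNC chi | refines pi rho && refines rho sigma) muBNC chi rho sigma
  = (pi == sigma)%:R.
Proof.
move=> piB sB ps; pose e (i : 'I_#|BNC chi|) := enum_val i : {set {set 'I_n}}.
have eB i : e i \in BNC chi by apply: enum_valP.
pose M : 'M[int]_#|BNC chi| := \matrix_(i, j) (if refines (e i) (e j) then muBNC chi (e i) (e j) else 0).
pose Z : 'M[int]_#|BNC chi| := \matrix_(i, j) (refines (e i) (e j))%:R.
have MZ : M *m Z = 1%:M.
  apply/matrixP => i j; rewrite !mxE -(inj_eq enum_val_inj).
  have -> : \sum_k M i k * Z k j =
      \sum_(rho in BNC chi | refines (e i) rho && refines rho (e j)) muBNC chi (e i) rho.
    rewrite [RHS]big_mkcondr [RHS]big_enum_val /=; apply: eq_bigr => k _; rewrite !mxE.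
    by case: ifP => _; case: (refines (e k) (e j)); rewrite ?mulr1 ?mulr0 ?mul0r.
  have [rij|nrij] := boolP (refines (e i) (e j)); first exact: muBNC_sum.
  rewrite big_pred0; last first.
    by move=> rho; apply/negbTE; apply: contra nrij => /and3P[_]; apply: refines_trans.
  by case: eqP => // eij; rewrite /e eij refines_refl in nrij.
have /matrixP := mulmx1C MZ.
move=> /(_ (enum_rank_in piB pi) (enum_rank_in piB sigma)).
rewrite !mxE -(inj_eq enum_val_inj) !enum_rankK_in // => <-.
rewrite [LHS]big_mkcondr [LHS]big_enum_val /=; apply: eq_bigr => k _.
rewrite !mxE /e !enum_rankK_in //.
by case: (refines pi _); case: (refines _ sigma); rewrite ?mul1r ?mulr0 ?mul0r.
Qed.

Lemma block_unique pi B V V' (D : {set 'I_n}) : partition pi D -> V \in pi -> V' \in pi ->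
  B != set0 -> B \subset V -> B \subset V' -> V = V'.
Proof.
move=> ppi Vpi V'pi /set0Pn[x xB] /subsetP/(_ x xB) xV /subsetP/(_ x xB) xV'.
by rewrite -(def_pblock (partition_trivIset ppi) Vpi xV) (def_pblock (partition_trivIset ppi) V'pi xV').
Qed.

(** The interval below [pi] is a product: [rho <= pi] corresponds to the family of its
    traces on the blocks of [pi].  A crossing of blocks of [rho] lying in different
    blocks of [pi] would be a crossing in [pi]. *)
Lemma prod_ncpart (K : fieldType) (wt : {set 'I_n} -> K) pi : pi \in BNC chi ->
  \prod_(V in pi) \sum_(sigma in ncpart chi V) \prod_(B in sigma) wt B =
  \sum_(rho in BNC chi | refines rho pi) \prod_(B in rho) wt B.
Proof.
rewrite !BNC_ncpart inE => /andP[ppi /crossfreeP cpi].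
(* The trace of [rho] on [V]; the value off [pi] is the one prescribed by [pfamily]. *)
pose h rho := [ffun V => if V \in pi then [set B in rho | B \subset V] else set0].
rewrite (big_distr_big_dep set0).
rewrite (reindex_onto h (fun f : {ffun _} => \bigcup_(V in pi) f V)) /=; last first.
  move=> f /pfamilyP[/supportP sf hf]; apply/ffunP => V; rewrite ffunE.
  case: ifP => [Vpi|/negbT Vpi]; last by rewrite sf.
  have /andP[pfV _] : partition (f V) V && crossfree chi (f V) by have := hf V Vpi; rewrite inE.
  apply/setP => B; rewrite inE; apply/andP/idP => [[/bigcupP[V' V'pi BV'] BV]|BV].
    have /andP[pfV' _] : partition (f V') V' && crossfree chi (f V') by have := hf V' V'pi; rewrite inE.
    have -> // : V = V'.
    apply: (block_unique ppi Vpi V'pi (partition_neq0 pfV' BV')) => //.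
    exact: partitionS BV'.
  by split; [apply/bigcupP; exists V | exact: partitionS BV].
have h_in rho V : V \in pi -> h rho V = [set B in rho | B \subset V] by rewrite ffunE => ->.
have key rho : ((h rho \in pfamily set0 (mem pi) (ncpart chi)) &&
    (\bigcup_(V in pi) h rho V == rho)) = (rho \in ncpart chi [set: 'I_n]) && refines rho pi.
  apply/idP/idP.
    case/andP => /pfamilyP[_ hf] /eqP e.
    have part V : V \in pi -> partition [set B in rho | B \subset V] V /\
        crossfree chi [set B in rho | B \subset V].
      by move=> Vpi; have := hf V Vpi; rewrite h_in // inE => /andP.
    have inV B : B \in rho -> exists2 V, V \in pi & B \subset V.
      by rewrite -{1}e => /bigcupP[V Vpi]; rewrite h_in // inE => /andP[_ BV]; exists V.
    have mem B V : B \in rho -> B \subset V -> B \in [set B in rho | B \subset V].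
      by move=> Br BV; rewrite inE Br.
    rewrite inE -andbA; apply/and3P; split.
    - apply/and3P; split.
      + rewrite eqEsubset subsetT; apply/subsetP => x _.
        have /bigcupP[V Vpi xV] : x \in cover pi by rewrite (cover_partition ppi) inE.
        have [pV _] := part V Vpi.
        have /bigcupP[B] : x \in cover [set B in rho | B \subset V] by rewrite (cover_partition pV).
        by rewrite inE => /andP[Br _] xB; apply/bigcupP; exists B.
      + apply/trivIsetP => B B' Br B'r nBB'.
        have [V Vpi BV] := inV B Br; have [V' V'pi B'V'] := inV B' B'r.
        have [eV|nV] := eqVneq V V'.
          rewrite -{V' V'pi}eV in B'V'.
          by apply: (trivIsetP (partition_trivIset (part V Vpi).1)); rewrite ?mem.
        have := trivIsetP (partition_trivIset ppi) V V' Vpi V'pi nV.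
        by move=> d; apply: disjointWl BV _; apply: disjointWr B'V' d.
      apply/negP => r0; have [V Vpi BV] := inV _ r0.
      by have := partition0 (part V Vpi).1; rewrite mem.
    - apply/crossfreeP => B B' a b c d Br B'r aB bB' cB dB' ab bc cd.
      have [V Vpi BV] := inV B Br; have [V' V'pi B'V'] := inV B' B'r.
      have eV : V = V'.
        have sV := subsetP BV; have sV' := subsetP B'V'.
        by apply: (cpi V V' a b c d) => //; [apply: sV | apply: sV' | apply: sV | apply: sV'].
      rewrite -{V' V'pi}eV in B'V'.
      by apply: (crossfreeP _ _ (part V Vpi).2 B B' a b c d); rewrite ?mem.
    apply/forall_inP => B /inV[V Vpi BV]; apply/exists_inP; by exists V.
  case/andP; rewrite inE => /andP[pr cr] /forall_inP rr.
  apply/andP; split.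
    apply/pfamilyP; split.
      by apply/supportP => V Vpi; rewrite ffunE (negbTE Vpi).
    move=> V Vpi; rewrite h_in // inE; apply/andP; split.
      apply/and3P; split.
      + rewrite eqEsubset; apply/andP; split.
          by apply/bigcupsP => B; rewrite inE => /andP[].
        apply/subsetP => x xV.
        have /bigcupP[B Br xB] : x \in cover rho by rewrite (cover_partition pr) inE.
        apply/bigcupP; exists B => //; rewrite inE Br /=.
        have /exists_inP[V' V'pi BV'] := rr B Br.
        have tp := partition_trivIset ppi.
        by rewrite -(def_pblock tp Vpi xV) (def_pblock tp V'pi) // (subsetP BV').
      + apply: trivIsetS (partition_trivIset pr).
        by apply/subsetP => B; rewrite inE => /andP[].
      by rewrite inE (partition0 pr).
    apply/crossfreeP => B B' a b c d; rewrite !inE => /andP[Br _] /andP[B'r _].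
    exact: (crossfreeP _ _ cr).
  apply/eqP/setP => B; apply/bigcupP/idP => [[V Vpi]|Br].
    by rewrite h_in // inE => /andP[].
  have /exists_inP[V Vpi BV] := rr B Br; exists V => //.
  by rewrite h_in // inE Br.
apply: eq_big => [rho|rho /[!key]]; first exact: key.
case/andP; rewrite inE => /andP[pr _] /forall_inP rr.
transitivity (\prod_(V in pi) \prod_(B in rho | B \subset V) wt B).
  by apply: eq_bigr => V Vpi; rewrite h_in //; apply: eq_bigl => B; rewrite inE.
rewrite (exchange_big_dep (mem rho)) /=; last by move=> V B _ /andP[].
apply: eq_bigr => B Br; have /exists_inP[V Vpi BV] := rr B Br.
rewrite (big_pred1 V) // => V'; rewrite Br /=.
apply/andP/eqP => [[V'pi BV']|->//].
exact: block_unique ppi V'pi Vpi (partition_neq0 pr Br) BV' BV.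
Qed.

Lemma mobius_inversion (K : fieldType) (wt : {set 'I_n} -> K) : (0 < n)%N ->
  \sum_(pi in BNC chi) (muBNC chi pi (one_part n))%:~R *
     \prod_(V in pi) \sum_(sigma in ncpart chi V) \prod_(B in sigma) wt B
  = wt [set: 'I_n].
Proof.
move=> n0; have oB := one_part_BNC n0.
under eq_bigr => pi piB do rewrite prod_ncpart // mulr_sumr.
rewrite (exchange_big_dep (mem (BNC chi))) /=; last by move=> pi rho _ /andP[].
transitivity (\sum_(rho in BNC chi) (rho == one_part n)%:R * \prod_(B in rho) wt B).
  apply: eq_bigr => rho rB; rewrite -mulr_suml; congr (_ * _).
  rewrite -(rmorph_nat (intmul 1)) -(muBNC_sum_left rB oB) ?refines_one_part //.
  rewrite rmorph_sum /=; apply: eq_bigl => pi.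
  by rewrite rB refines_one_part andbT.
rewrite (bigD1 (one_part n)) //= eqxx mul1r big_set1 big1 ?addr0 // => rho /andP[_ /negbTE->].
by rewrite mul0r.
Qed.
End Inversion.

(** * Vanishing of mixed cumulants, and the theorem *)

Section Additivity.
Variables (K : fieldType) (I J : Type) (A : algType K) (phi : A -> K).
Variables (kappa : cumulant_family A) (z : bool -> I + J -> A).
Hypothesis kappaP : is_cumulants phi kappa.
Variables (X : bool -> pvspace K).
Variables (l : forall d, ncpoly K I -> {linear X d -> X d}).
Variables (r : forall d, ncpoly K J -> {linear X d -> X d}).
Hypothesis model_moments : forall w : seq (bool * (I + J)),
  vstate (foldr (fun q T => model_op l r q.1 q.2 \o T) idfun w)
  = phi (\prod_(q <- w) z q.1 q.2).

(** Expand the mixed moment once by the moment-cumulant formula and once by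
    [model_mixed_moment]: by induction the terms agree except for the partition with
    one block, so these two terms agree as well. *)
Lemma mixed_cumulant n (alpha : 'I_n -> I + J) (eps : 'I_n -> bool) : (0 < n)%N ->
  kappa (chi_of alpha) (fun k => z (eps k) (alpha k)) =
  \sum_(d | [forall k, eps k == d]) kappa (chi_of alpha) (fun k => z d (alpha k)).
Proof.
move: {2}n.+1 (ltnSn n) => m; elim: m n alpha eps => // m IH n alpha eps nm n0.
pose a (k : 'I_n) := z (eps k) (alpha k).
pose wt := block_cumulant kappa (chi_of alpha) a.
have eall p (f : 'I_p -> bool) d : [forall k, f k == d] = ([set: 'I_p] \subset [set x | f x == d]).
  apply/forallP/subsetP => [h k _|h k]; first by rewrite inE.
  by have := h k (in_setT k); rewrite inE.
have eT : wt [set: 'I_n] = kappa (chi_of alpha) a by exact: restr_setT.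
have eM : mixed_weight (family_weight kappa z alpha) eps [set: 'I_n] =
    \sum_(d | [forall k, eps k == d]) kappa (chi_of alpha) (fun k => z d (alpha k)).
  by apply: eq_big => [d|d _]; [rewrite eall | exact: restr_setT].
have oB := one_part_BNC (chi_of alpha) n0.
have : \sum_(pi in BNC (chi_of alpha)) \prod_(V in pi) wt V =
    \sum_(pi in BNC (chi_of alpha)) \prod_(V in pi) mixed_weight (family_weight kappa z alpha) eps V.
  rewrite -(model_mixed_moment kappaP model_moments alpha eps n0).
  by have [_ hk] := kappaP; rewrite (hk _ (chi_of alpha) a n0).
rewrite (bigD1 (one_part n)) //= [in RHS](bigD1 (one_part n)) //= !big_set1 eT eM.
have -> : \sum_(pi in BNC (chi_of alpha) | pi != one_part n) \prod_(V in pi) wt V =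
    \sum_(pi in BNC (chi_of alpha) | pi != one_part n)
      \prod_(V in pi) mixed_weight (family_weight kappa z alpha) eps V; last exact: addIr.
apply: eq_bigr => pi /andP[piB ne]; apply: eq_bigr => V Vpi.
have ppi := BNC_partition piB.
have Vm : (#|V| < m)%N by rewrite -ltnS in nm; apply: leq_trans (partition_block_lt ppi ne Vpi) _.
have := IH _ (restr alpha V) (restr eps V) Vm (partition_block_gt0 ppi Vpi).
move=> e; apply: etrans e _; apply: eq_bigl => d.
apply/forallP/subsetP => [h x xV|h t].
  by have := h (enum_rank_in xV x); rewrite inE /restr enum_rankK_in.
by have := h (enum_val t) (enum_valP t); rewrite inE.
Qed.

(** Multilinearity expands one slot at a time: with the first [t] slots filled by sums
    and the others by the colours [eps], only colours compatible with [eps] beyond [t]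
    survive. *)
Lemma cumulant_additive n (alpha : 'I_n -> I + J) : (0 < n)%N ->
  kappa (chi_of alpha) (fun k => z false (alpha k) + z true (alpha k)) =
  kappa (chi_of alpha) (fun k => z false (alpha k)) + kappa (chi_of alpha) (fun k => z true (alpha k)).
Proof.
move=> n0; set chi := chi_of alpha.
pose hybrid t (eps : 'I_n -> bool) (k : 'I_n) :=
  if (k < t)%N then z false (alpha k) + z true (alpha k) else z (eps k) (alpha k).
have gen t : (t <= n)%N -> forall eps : 'I_n -> bool, kappa chi (hybrid t eps) =
    \sum_(d | [forall k : 'I_n, (t <= k)%N ==> (eps k == d)]) kappa chi (fun k => z d (alpha k)).
  elim: t => [|t IH] tn eps.
    exact: mixed_cumulant.
  pose i := Ordinal tn; pose upd b (k : 'I_n) := if k == i then b else eps k.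
  have eh b : hybrid t (upd b) = [eta hybrid t eps with i |-> z b (alpha i)].
    by apply/funext => k; rewrite /hybrid /upd /=; case: eqP => [->|//]; rewrite /= ltnn.
  have -> : hybrid t.+1 eps = [eta hybrid t eps with i |-> 1 *: z false (alpha i) + z true (alpha i)].
    apply/funext => k; rewrite /hybrid /= scale1r ltnS leq_eqVlt -[k == i]val_eqE /=.
    by case: eqP => [/= e|//]; have -> : k = i by apply: val_inj.
  have [ml _] := kappaP; rewrite ml mul1r -!eh !IH ?(ltnW tn) //.
  have eP b d : [forall k : 'I_n, (t <= k)%N ==> (upd b k == d)] =
      (b == d) && [forall k : 'I_n, (t < k)%N ==> (eps k == d)].
    apply/forallP/andP => [h|[bd /forallP h] k].
      split; first by have := h i; rewrite /upd eqxx leqnn.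
      apply/forallP => k; apply/implyP => tk; have := h k; rewrite (ltnW tk) /upd.
      by rewrite -val_eqE gtn_eqF.
    apply/implyP => tk; rewrite /upd; case: (eqVneq k i) => [//|ki]; have := h k.
    by rewrite ltn_neqAle tk andbT -[t]/(val i) eq_sym val_eqE ki.
  rewrite (eq_bigl _ _ (eP false)) (eq_bigl _ _ (eP true)).
  rewrite [X in X + _ = _]big_mkcond [X in _ + X = _]big_mkcond [RHS]big_mkcond !big_bool /=.
  by rewrite addr0 add0r addrC.
have := gen n (leqnn n) (fun _ => false).
have -> : hybrid n (fun _ => false) = fun k => z false (alpha k) + z true (alpha k).
  by apply/funext => k; rewrite /hybrid ltn_ord.
move=> ->; rewrite [LHS]big_mkcond big_bool /=.
have all_true (d : bool) : [forall k : 'I_n, (n <= k)%N ==> (false == d)] = true.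
  by apply/forallP => k; rewrite leqNgt ltn_ord.
by rewrite !all_true addrC.
Qed.
End Additivity.

Section Polynomial.
Variables (K : fieldType) (I J : Type) (n : nat) (alpha : 'I_n -> I + J).

Lemma big_nesub (R : Type) (idx : R) (op : Monoid.com_law idx) (F : {set 'I_n} -> R) pi :
  pi \in BNC (chi_of alpha) ->
  \big[op/idx]_(V : nesub n | val V \in pi) F (val V) = \big[op/idx]_(V in pi) F V.
Proof.
move=> /BNC_partition ppi.
have e : pi = [set val V | V in [set V : nesub n | val V \in pi]].
  apply/setP => V; apply/idP/imsetP => [Vpi|[W]]; last by rewrite inE => Wpi ->.
  by exists (Sub V (partition_neq0 ppi Vpi) : nesub n); rewrite ?inE SubK.
rewrite [in RHS]e big_imset; last by move=> V W _ _; apply: val_inj.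
by apply: eq_bigl => V; rewrite inE.
Qed.

Lemma Rweight1 (W : nesub n) : Rweight U_(enum_rank W) = #|val W|.
Proof.
rewrite /Rweight (bigD1 W) //= mnm1E eqxx mul1n big1 ?addn0 // => V VW.
by rewrite mnm1E (inj_eq enum_rank_inj) eq_sym (negbTE VW).
Qed.

Lemma Rpoly_homog : Rpoly K alpha \is n.-homog for (@Rweight n).
Proof.
apply: rpred_sum => pi piB; apply: rpredZ; rewrite /Rindet mprodXE dhomogX /=.
rewrite (big_morph (@Rweight n) (@RweightD n) (@Rweight0 n)).
rewrite (eq_bigr (fun V : nesub n => #|val V|)) => [|V _]; last exact: Rweight1.
rewrite (big_nesub _ (fun V : {set 'I_n} => #|V|) piB).
by rewrite -(card_partition (BNC_partition piB)) cardsT card_ord.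
Qed.

Lemma RevalE (A : algType K) (phi : A -> K) (z : I + J -> A) :
  Reval phi alpha z = \sum_(pi in BNC (chi_of alpha))
    (muBNC (chi_of alpha) pi (one_part n))%:~R *
      \prod_(V in pi) phi (\prod_(k < n | k \in V) z (alpha k)).
Proof.
rewrite /Reval /Rpoly raddf_sum; apply: eq_bigr => pi piB /=.
rewrite mevalZ rmorph_prod /= -(big_nesub _ _ piB) //; congr (_ * _).
by apply: eq_bigr => V _; rewrite /Rindet mevalXU enum_rankK.
Qed.

Lemma Reval_cumulant (A : algType K) (phi : A -> K) (kappa : cumulant_family A) (z : I + J -> A) :
  is_cumulants phi kappa -> (0 < n)%N ->
  Reval phi alpha z = kappa n (chi_of alpha) (fun k => z (alpha k)).
Proof.
move=> hk n0; rewrite RevalE; pose wt := block_cumulant kappa (chi_of alpha) (fun k => z (alpha k)).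
have <- : wt [set: 'I_n] = kappa n (chi_of alpha) (fun k => z (alpha k)) by exact: restr_setT.
rewrite -(mobius_inversion (chi_of alpha) wt n0).
apply: eq_bigr => pi piB; congr (_ * _); apply: eq_bigr => V Vpi.
apply: moment_cumulant_subset hk _; exact: partition_neq0 (BNC_partition piB) Vpi.
Qed.
End Polynomial.

Theorem proposition4p4p2 (R : realType) (I J : Type) (n : nat) (hn : (0 < n)%N)
    (alpha : 'I_n -> I + J) :
  (Rpoly R[i] alpha \is n.-homog for (@Rweight n)) /\
  (forall (A : algType R[i]) (phi : {scalar A}), phi 1 = 1 ->
    (forall (z : I + J -> A) (kappa : cumulant_family A), is_cumulants phi kappa ->
       Reval phi alpha z = kappa n (chi_of alpha) (fun k => z (alpha k))) /\
    (forall z' z'' : I + J -> A, bifree phi z' z'' ->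
       Reval phi alpha (fun k => z' k + z'' k) = Reval phi alpha z' + Reval phi alpha z'')).
Proof.
split; first exact: Rpoly_homog.
move=> A phi _; split=> [z kappa kappaP|z' z'' [X [l [r [_ _ model]]]]].
  exact: Reval_cumulant.
have [kappa kappaP] := cumulants_exist phi.
rewrite !(Reval_cumulant _ _ kappaP hn).
pose z (d : bool) := if d then z'' else z'.
exact: (cumulant_additive (z := z) kappaP model).
Qed.
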